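(* Let $N$ be a positive integer. Suppose $(\rho^\varepsilon,\phi^\varepsilon)=(\rho_1^\varepsilon,\dots,\rho_N^\varepsilon,\phi_1^\varepsilon,\dots,\phi_N^\varepsilon)$ is a sequence (indexed by a sequence of nonzero reals $\varepsilon\to0$) of relative equilibria of the $(N+1)$-vortex problem which converges, as $\varepsilon\to0$, to a relative equilibrium $(\rho,\phi)=(1,\dots,1,\phi_1,\dots,\phi_N)$ of the $(1+N)$-vortex problem, where $\phi$ is a nondegenerate critical point of the potential $$V(\theta)=-\sum_{1\le i<j\le N}\left(\cos(\theta_i-\theta_j)+\frac12\log\bigl(2-2\cos(\theta_i-\theta_j)\bigr)\right).$$ Then there is $\varepsilon_0>0$ such that, for all $\varepsilon$ in the sequence with $0<|\varepsilon|<\varepsilon_0$: (1) $(\rho^\varepsilon,\phi^\varepsilon)$ is nondegenerate; (2) if $\varepsilon>0$, then $(\rho^\varepsilon,\phi^\varepsilon)$ is linearly stable if and only if $\phi$ is a local minimum of $V$; (3) if $\varepsilon<0$, then $(\rho^\varepsilon,\phi^\varepsilon)$ is linearly stable if and only if $\phi$ is a local maximum of $V$.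
   Context: For $(x,y)\in\mathbb{R}^2$ write $(x,y)^\perp=(-y,x)$. The $(N+1)$-vortex problem with circulations $\Gamma_0=1$, $\Gamma_1=\dots=\Gamma_N=\varepsilon$ (where $\varepsilon\in\mathbb{R}$ may have either sign) is the system for pairwise distinct $q_0,\dots,q_N\in\mathbb{R}^2$ $$\dot q_j=\sum_{i=0,\,i\ne j}^N \Gamma_i\frac{(q_j-q_i)^\perp}{|q_j-q_i|^2},\qquad j=0,\dots,N.$$ A relative equilibrium of it is a configuration that is a fixed point in the frame rotating rigidly about the origin at rate $\omega=1$, i.e. $q_j^\perp=\sum_{i\ne j}\Gamma_i\frac{(q_j-q_i)^\perp}{|q_j-q_i|^2}$ for all $j$; the center of vorticity is always taken at the origin: $q_0=-\varepsilon(q_1+\dots+q_N)$. A configuration for given $\varepsilon$ is therefore determined by the polar coordinates $(r,\theta)=(r_1,\dots,r_N,\theta_1,\dots,\theta_N)$ of $q_1,\dots,q_N$; for the limit $\varepsilon=0$ one has $q_0=0$. A relative equilibrium of the $(1+N)$-vortex problem is a limit $(q_0,\dots,q_N)$ of relative equilibria $(q_0^k,\dots,q_N^k)$ of the $(N+1)$-vortex problem with $\varepsilon=\varepsilon_k\ne0$, $\varepsilon_k\to0$, where for some $m,M>0$ independent of $k$ one has $|q_i^k-q_j^k|\ge m$ for $i\neq j$ and $|q_j^k|\le M$ for all $j$. Reduced system: substitute $q_0=-\varepsilon(q_1+\dots+q_N)$ into the equations for $q_1,\dots,q_N$ and write the resulting $2N$ equations in polar coordinates $(r,\theta)$ in the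 frame rotating at rate $1$ (so that relative equilibria are fixed points). The linearization of this $2N$-dimensional system at a relative equilibrium always has at least two zero eigenvalues, coming from the rotation and scaling symmetries. A relative equilibrium of the $(N+1)$-vortex problem is called nondegenerate if this linearization has exactly two zero eigenvalues (counted with multiplicity). It is called linearly stable if, apart from the two zero eigenvalues due to the symmetries, all the remaining $2N-2$ eigenvalues of the linearization are purely imaginary and nonzero. $V$ is defined for $\theta\in\mathbb{R}^N$ with $\theta_i\not\equiv\theta_j\pmod{2\pi}$ for $i\neq j$. Its Hessian $V_{\theta\theta}$ always has the null vector $(1,\dots,1)^T$; a critical point $\theta$ is called nondegenerate if $V_{\theta\theta}(\theta)$ has only one zero eigenvalue. A nondegenerate critical point is a local minimum (respectively maximum) when $V_{\theta\theta}$ is positive (respectively negative) semidefinite with one-dimensional null space. *)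

(* Defs.v *)
From HB Require Import structures.
From mathcomp Require Import all_boot all_order all_algebra.
From mathcomp Require Import complex.
From mathcomp Require Import all_classical all_reals all_analysis.

Set Implicit Arguments.
Unset Strict Implicit.
Unset Printing Implicit Defensive.

Import Order.TTheory GRing.Theory Num.Theory.
Import numFieldNormedType.Exports.

Local Open Scope classical_set_scope.
Local Open Scope ring_scope.

Section Vortices.
Variable R : realType.

Definition perp (p : R * R) : R * R := (- p.2, p.1).
Definition dot (p p' : R * R) : R := p.1 * p'.1 + p.2 * p'.2.
(* The library norm on R * R is the sup norm, hence this definition.          *)
Definition enorm (p : R * R) : R := Num.sqrt (dot p p).

Definition circulation N (eps : R) (j : 'I_N.+1) : R :=
  if j == ord0 then 1 else eps.

Definition velocity N (eps : R) (q : 'I_N.+1 -> R * R) (j : 'I_N.+1) : R * R :=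
  \sum_(i < N.+1 | i != j)
    (circulation eps i / enorm (q j - q i) ^+ 2) *: perp (q j - q i).

Definition central_position N (eps : R) (q : 'I_N -> R * R) : R * R :=
  - eps *: \sum_(j < N) q j.

Definition rel_equilibrium N (eps : R) (q : 'I_N.+1 -> R * R) : Prop :=
  [/\ injective q,
      q ord0 = central_position eps (fun j : 'I_N => q (lift ord0 j))
    & forall j, perp (q j) = velocity eps q j].

Definition limit_rel_equilibrium N (q : 'I_N.+1 -> R * R) : Prop :=
  exists (eps : nat -> R) (qs : nat -> 'I_N.+1 -> R * R) (m M : R),
    [/\ 0 < m /\ 0 < M,
        (forall k, eps k != 0) /\ eps @ \oo --> (0 : R),
        forall k, rel_equilibrium (eps k) (qs k),
        (forall k i j, i != j -> m <= enorm (qs k i - qs k j)) /\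
        (forall k j, enorm (qs k j) <= M)
      & forall j, (fun k => qs k j) @ \oo --> q j].

Definition radial_dir (t : R) : R * R := (cos t, sin t).
Definition angular_dir (t : R) : R * R := (- sin t, cos t).

(* The small vortices are those of index [lift ord0 j], j < N.                *)
Definition polar_config N (eps : R) (r t : 'rV[R]_N) : 'I_N.+1 -> R * R :=
  let q (j : 'I_N) : R * R := r 0 j *: radial_dir (t 0 j) in
  fun i => if unlift ord0 i is Some j then q j else central_position eps q.

Definition polar_rel_equilibrium N (eps : R) (r t : 'rV[R]_N) : Prop :=
  (forall j, 0 < r 0 j) /\ rel_equilibrium eps (polar_config eps r t).

(* Velocity of the j-th small vortex in the frame rotating at rate 1.         *)
Definition rotating_velocity N (eps : R) (r t : 'rV[R]_N) (j : 'I_N) : R * R :=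
  let q := polar_config eps r t in
  velocity eps q (lift ord0 j) - perp (q (lift ord0 j)).

(* With q_j = r_j e_r(t_j), the polar components of a planar velocity v_j are *)
(* r_j' = <v_j, e_r(t_j)> and t_j' = <v_j, e_t(t_j)> / r_j; the state (r, t)  *)
(* is encoded as the row vector [row_mx r t].                                 *)
Definition reduced_field N (eps : R) (x : 'rV[R]_(N + N)) : 'rV[R]_(N + N) :=
  let r := lsubmx x in
  let t := rsubmx x in
  row_mx
    (\row_j dot (rotating_velocity eps r t j) (radial_dir (t 0 j)))
    (\row_j (dot (rotating_velocity eps r t j) (angular_dir (t 0 j)) / r 0 j)).

(* The library Jacobian acts on row vectors, so this is the transpose of the  *)
(* usual Jacobian matrix; both have the same characteristic polynomial.       *)
Definition linearization N (eps : R) (r t : 'rV[R]_N) : 'M[R]_(N + N) :=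
  jacobian (@reduced_field N eps) (row_mx r t).

Definition nondegenerate_equilibrium N (eps : R) (r t : 'rV[R]_N) : Prop :=
  mup 0 (char_poly (linearization eps r t)) = 2%N.

(* s lists, with multiplicity, the 2 N - 2 complex eigenvalues that remain    *)
(* once two zero eigenvalues have been removed.                               *)
Definition linearly_stable N (eps : R) (r t : 'rV[R]_N) : Prop :=
  exists s : seq R[i],
    char_poly (map_mx (real_complex R) (linearization eps r t))
      = 'X^2 * \prod_(z <- s) ('X - z%:P)
    /\ (forall z, z \in s -> complex.Re z = 0 /\ z != 0).

Definition potential N (t : 'rV[R]_N) : R :=
  - \sum_(i < N) \sum_(j < N | (i < j)%N)
      (cos (t 0 i - t 0 j) + 2^-1 * ln (2 - 2 * cos (t 0 i - t 0 j))).

Definition noncollision N (t : 'rV[R]_N) : Prop :=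
  forall i j, i != j -> forall n : int, t 0 i - t 0 j != n%:~R * (2 * pi).

Definition partial N (i : 'I_N) (f : 'rV[R]_N -> R) : 'rV[R]_N -> R :=
  fun t => 'D_(delta_mx 0 i : 'rV[R]_N) f t.

Definition hessian N (f : 'rV[R]_N -> R) (t : 'rV[R]_N) : 'M[R]_N :=
  \matrix_(i, j) partial i (partial j f) t.

Definition critical_point N (t : 'rV[R]_N) : Prop :=
  noncollision t /\ forall i, partial i (@potential N) t = 0.

Definition nondegenerate_critical_point N (t : 'rV[R]_N) : Prop :=
  critical_point t /\ mup 0 (char_poly (hessian (@potential N) t)) = 1%N.

Definition nondegenerate_local_min N (t : 'rV[R]_N) : Prop :=
  let H := hessian (@potential N) t in
  [/\ nondegenerate_critical_point t,
      forall v : 'rV[R]_N, 0 <= (v *m H *m v^T) 0 0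
    & \rank (kermx H) = 1%N].

Definition nondegenerate_local_max N (t : 'rV[R]_N) : Prop :=
  let H := hessian (@potential N) t in
  [/\ nondegenerate_critical_point t,
      forall v : 'rV[R]_N, (v *m H *m v^T) 0 0 <= 0
    & \rank (kermx H) = 1%N].

End Vortices.

(* Main.v *)
Require Import Defs.
From HB Require Import structures.
From mathcomp Require Import all_boot all_order all_algebra.
From mathcomp Require Import complex.
From mathcomp Require Import all_classical all_reals all_analysis.
From mathcomp Require Import ring lra.
Set Implicit Arguments.
Unset Strict Implicit.
Unset Printing Implicit Defensive.

Import Order.TTheory GRing.Theory Num.Theory.
Import numFieldNormedType.Exports.

Local Open Scope classical_set_scope.
Local Open Scope ring_scope.

(** In complex notation, with q_j = r_j exp(i t_j), the reduced system reads
    q_j' = i / conj (q_j - q_0) + eps sum_(k != j) i / conj (q_j - q_k) - i q_j.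

    _Asymptotics_.  Differentiating at an equilibrium, and using the
    equilibrium equation itself to write 1 / conj (q_j - q_0) as
    q_j - eps sum_k 1 / conj (q_j - q_k), turns the linearization L into an
    expression that is polynomial in eps up to factors that stay away from the
    singularities.  In the coordinates (radii, angles) it has the blocks
    [eps A, U; eps B, eps D], where U tends to - 2 and B tends to the Hessian H
    of the potential, while A and D only stay bounded
    ([linearization_blocks], [blk_rt_limit], [blk_tr_limit]).  With
    s = sqrt |eps| and sg the sign of eps, multiplying the angles and the time
    by s transforms L into a matrix M that converges to [0, - 2; sg H, 0].  For
    small eps the eigenvalues are thus s mu, where mu^2 is close to - 2 sg d and
    d is an eigenvalue of H.

    _Exact structure_.  The limit alone decides neither whether zero is
    exactly a double eigenvalue nor whether nearby eigenvalues stay on the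
    imaginary axis.  For the first point, rotations and dilations give a Jordan
    block of size two for the eigenvalue 0 ([rotation_kernel],
    [dilation_eq], [X2_dvd_char_poly]), and the coefficient of X^2 in the
    characteristic polynomial of the limit is a nonzero multiple of the
    coefficient of X in that of H.  For the second, the system is Hamiltonian:
    there is an antisymmetric matrix J such that M J is symmetric
    ([linearization_hamiltonian]).

    _Conclusion_.  If sg H is positive semidefinite, then M J is positive
    definite modulo the rotations for small eps, because its limit is
    [2, 0; 0, sg H]; by Krein's argument the nonzero eigenvalues of M are then
    imaginary ([krein], [limit_stable]).  If sg H has a negative eigenvalue d,
    the characteristic polynomial p of M tends to 0 at x = sqrt (- 2 d),
    whereas linear stability forces |p(x)| >= x^(2 N) for all x >= 0, each
    imaginary root being at distance at least x from x ([limit_unstable],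
    [spectrally_stable_lower_bound]).  For eps > 0 the condition on sg H says
    that the critical point is a minimum, for eps < 0 that it is a maximum. *)

(** * Characteristic polynomials *)

Section CharPoly.
Variable F : fieldType.

(** The effect on the characteristic polynomial of the linear change of
    coordinates [D] combined with a change of the unit of time by [s]. *)
Lemma char_poly_scaled_similar n (D A B : 'M[F]_n) (s : F) :
  D \in unitmx -> D *m A = s *: (B *m D) ->
  char_poly A \Po (s *: 'X) = s ^+ n *: char_poly B.
Proof.
move=> uD DA; rewrite /char_poly -det_map_mx/=.
have key : map_mx polyC D *m map_mx (comp_poly (s *: 'X)) (char_poly_mx A)
         = s%:P *: (char_poly_mx B *m map_mx polyC D).
  have -> : map_mx (comp_poly (s *: 'X)) (char_poly_mx A)
     = (s *: 'X)%:M - map_mx polyC A.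
    apply/matrixP=> i j; rewrite !mxE comp_polyB comp_polyC.
    by case: (i == j); rewrite ?comp_polyX ?mulr0n ?comp_poly0.
  rewrite mulmxBr -map_mxM DA map_mxZ /char_poly_mx mulmxBl map_mxM scalerBr.
  congr (_ - _); rewrite mul_mx_scalar mul_scalar_mx scalerA mul_polyC //.
have := congr1 (fun M => \det M) key.
rewrite !det_mulmx detZ det_mulmx mulrA mulrC -mul_polyC => h.
have h0 : \det (map_mx polyC D) != 0.
  by rewrite det_map_mx polyC_eq0 -unitfE -unitmxE.
apply: (mulIf h0); by rewrite h -mul_polyC rmorphXn.
Qed.

(** With w = c u + v X one has w (X - A) = X^2 v.  Multiplying by the adjugate
    of X - A shows that X^2 divides det (X - A) times each entry of w; an entry
    with u_i != 0 is prime to X. *)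
Lemma X2_dvd_char_poly n (A : 'M[F]_n) (u v : 'rV[F]_n) (c : F) :
  u != 0 -> c != 0 -> u *m A = 0 -> v *m A = c *: u -> 'X^2 %| char_poly A.
Proof.
move=> u0 c0 uA vA.
have [i ui] : exists i, u 0 i != 0.
  apply/existsP; apply: contra_neqT u0 => /existsPn h.
  by apply/rowP => i; rewrite mxE; apply/eqP; have := h i; rewrite negbK.
pose w : 'rV[{poly F}]_n := c%:P *: map_mx polyC u + 'X *: map_mx polyC v.
have wX : w *m char_poly_mx A = 'X^2 *: map_mx polyC v.
  rewrite /w /char_poly_mx mulmxBr !mul_mx_scalar mulmxDl -!scalemxAl -!map_mxM.
  rewrite uA vA map_mx0 scaler0 add0r map_mxZ scalerDr !scalerA expr2.
  by rewrite addrAC subrr add0r.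
have := congr1 (fun m => (m *m \adj (char_poly_mx A)) 0 i) wX.
rewrite -mulmxA mul_mx_adj mul_mx_scalar -scalemxAl !mxE => h.
have : 'X^2 %| char_poly A * (c%:P * (u 0 i)%:P + 'X * (v 0 i)%:P).
  by rewrite h dvdp_mulr.
rewrite Gauss_dvdpl // coprimep_expl //.
rewrite coprimep_sym -['X]subr0 -polyC0 coprimep_XsubC /root !hornerE /=.
by rewrite oppr0 mul0r addr0 mulf_neq0.
Qed.

(** The geometric multiplicity of 0 is at most the algebraic one: in the Gauss
    factorization of [A], the inverse of the invertible left factor turns
    n - rank A of the rows of X - A into multiples of X. *)
Lemma Xn_dvd_char_poly n (A : 'M[F]_n) : 'X^(n - \rank A) %| char_poly A.
Proof.
pose r : nat := \rank A.
pose B := map_mx polyC (invmx (col_ebase A)).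
pose U := map_mx polyC (row_ebase A).
pose I : 'M[{poly F}]_n := pid_mx r.
pose J : 'M[{poly F}]_n := copid_mx r.
have II : I *m I = I by rewrite /I pid_mx_id // rank_leq_row.
have IJ : I *m J = 0 by rewrite /J /copid_mx mulmxBr mulmx1 II subrr.
have JI : J *m I = 0 by rewrite /J /copid_mx mulmxBl mul1mx II subrr.
have JJ : J *m J = J by rewrite {1}/J /copid_mx mulmxBl mul1mx IJ subr0.
have eB : B *m char_poly_mx A = (I + 'X *: J) *m ('X *: (I *m B) + J *m B - I *m U).
  have -> : B *m char_poly_mx A = 'X *: B - I *m U.
    rewrite /char_poly_mx mulmxBr mul_mx_scalar -map_mxM; congr (_ - _).
    rewrite -{2}[A]mulmx_ebase -mulmxA mulKmx ?col_ebase_unit //.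
    by rewrite map_mxM map_pid_mx.
  rewrite mulmxDl !mulmxBr !mulmxDr -!scalemxAl -!scalemxAr !mulmxA II JJ IJ JI.
  rewrite !mul0mx !scaler0 addr0 add0r subr0 addrAC; congr (_ - _).
  by rewrite -scalerDr -mulmxDl /J /copid_mx addrC subrK mul1mx.
have dIJ : \det (I + 'X *: J) = 'X^(n - r).
  have -> : I + 'X *: J = diag_mx (\row_(i < n) if (i < r)%N then 1 else 'X).
    apply/matrixP=> i j; rewrite !mxE -[in i == j]val_eqE /=.
    case: (i == j :> nat); rewrite /= ?subr0 ?mulr0 ?addr0 //.
    by case: ltnP => _; rewrite ?subrr ?mulr0 ?addr0 ?subr0 ?add0r ?mulr1.
  rewrite det_diag; under eq_bigr do rewrite mxE.
  rewrite -(big_mkord xpredT (fun i => if (i < r)%N then 1 else 'X)).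
  rewrite (big_cat_nat (n := r)) ?rank_leq_row //= big_nat big1 => [|i /andP[_ ->]] //.
  rewrite mul1r -prodr_const_nat; apply: eq_big_nat => i /andP[ri _].
  by rewrite ltnNge ri.
have := congr1 (fun M => \det M) eB; rewrite !det_mulmx dIJ => h.
have : 'X^(n - r) %| \det B * char_poly A by rewrite h dvdp_mulr.
have -> : \det B = (\det (invmx (col_ebase A)))%:P by rewrite det_map_mx.
by rewrite mul_polyC dvdpZr // -unitfE -unitmxE unitmx_inv col_ebase_unit.
Qed.

Lemma dvdXn_mup (p : {poly F}) m : p != 0 -> (m <= mup 0 p)%N = ('X^m %| p).
Proof. by move=> p0; rewrite mup_geq // subr0. Qed.

Lemma dvdXnP (p : {poly F}) m : reflect (forall i, (i < m)%N -> p`_i = 0) ('X^m %| p).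
Proof.
apply: (iffP idP).
  by move=> /dvdpP [q ->] i im; rewrite coefMXn im.
move=> h; rewrite -(poly_take_drop m p).
have -> : take_poly m p = 0.
  by apply/polyP => i; rewrite coef_take_poly coef0; case: ltnP => // /h.
by rewrite add0r dvdp_mull.
Qed.
End CharPoly.

Section CharPolyReal.
Variable R : realType.

(** The determinant of [X, 2; - K, X] is that of X^2 + 2 K; this is seen after
    multiplication on the right by [X, 0; K, 1], which makes the matrix block
    triangular. *)
Lemma char_poly_antidiag n (K : 'M[R]_n) :
  char_poly (block_mx 0 (- 2)%:M K 0)
  = (- 2) ^+ n *: (char_poly K \Po (- 2^-1 *: 'X^2)).
Proof.
pose KX : 'M[{poly R}]_n := map_mx polyC K.
have eP : char_poly_mx (block_mx 0 (- 2)%:M K 0 : 'M[R]_(n + n))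
    = block_mx 'X%:M 2%:M (- KX) 'X%:M.
  rewrite /char_poly_mx map_block_mx (scalar_mx_block n n) opp_block_mx.
  rewrite add_block_mx !map_mx0 subr0 !add0r -/KX; congr block_mx.
  apply/matrixP => i j; rewrite !mxE polyCMn rmorphN /=.
  by rewrite -mulNrn opprK polyCMn.
pose Y : 'M[{poly R}]_n := ('X^2)%:M + 2 *: KX.
have eY : \det Y = (- 2%:P) ^+ n * (char_poly K \Po (- 2^-1 *: 'X^2)).
  rewrite /char_poly -det_map_mx -detZ; congr (\det _).
  apply/matrixP => i j; rewrite /Y !mxE /= comp_polyB comp_polyC.
  have -> : 'X *+ (i == j) \Po (- 2^-1 *: 'X^2)
      = (- 2^-1 *: 'X^2) *+ (i == j) :> {poly R}.
    by case: (i == j); rewrite ?comp_polyX ?comp_poly0.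
  have e2 : (2^-1)%:P * 2%:P = 1 :> {poly R} by rewrite -polyCM mulVf.
  have e3 : 2 = 2%:P :> {poly R} by rewrite polyCMn.
  rewrite {1}e3; case: (i == j); rewrite ?mulr0n ?mulr1n -?mul_polyC ?polyCN.
    move: e2 ('X^2); move: (2^-1)%:P 2%:P (K i j)%:P => a b c ab x.
    by rewrite mulrBr mulrA mulrNN mulNr opprK (mulrC b a) ab mul1r.
  by rewrite mulNr sub0r mulrN opprK add0r.
have h : block_mx 'X%:M 2%:M (- KX) 'X%:M *m block_mx 'X%:M 0 KX 1%:M
      = block_mx Y 2%:M 0 'X%:M.
  rewrite mulmx_block !mulmx0 !mulmx1 !add0r !mul_scalar_mx mul_mx_scalar.
  by rewrite scale_scalar_mx scalerN addNr -expr2.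
have /(congr1 (fun M => \det M)) := h.
rewrite det_mulmx det_lblock det_ublock det1 mulr1 !det_scalar eY => h2.
have X0 : ('X : {poly R}) ^+ n != 0 by rewrite expf_neq0 // polyX_eq0.
by rewrite /char_poly eP; apply: (mulIf X0);
  rewrite h2 -[(- 2) ^+ n *: _]mul_polyC polyC_exp polyCN polyCMn.
Qed.

(** Why a simple zero eigenvalue of the Hessian becomes a double one of the
    linearization: the first nonzero coefficients correspond. *)
Lemma coef2_char_poly_antidiag n (K : 'M[R]_n) :
  (char_poly (block_mx 0 (- 2)%:M K 0))`_2
  = - 2^-1 * (- 2) ^+ n * (char_poly K)`_1.
Proof.
rewrite char_poly_antidiag coefZ coef_comp_poly.
have -> : \sum_(i < size (char_poly K)) (char_poly K)`_i *
     ((- 2^-1 *: 'X^2) ^+ i)`_2 = (char_poly K)`_1 * - 2^-1 :> R.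
  under eq_bigr => i _ do rewrite exprZn -exprM coefZ coefXn.
  have z i : (2 == 2 * i.+2)%N = false by rewrite !mulnS.
  have [lt1|ge1] := ltnP 1 (size (char_poly K)).
    rewrite (bigD1 (Ordinal lt1)) //= mulr1 expr1 big1 ?addr0 // => i.
    case: i => -[|[|i]] ?; rewrite -val_eqE //= => _; first by rewrite !mulr0.
    by rewrite z !mulr0.
  rewrite [(char_poly K)`_1]nth_default // mul0r big1 // => -[[|[|i]] hi] _ /=.
  - by rewrite !mulr0.
  - by have := leq_trans hi ge1.
  - by rewrite z !mulr0.
ring.
Qed.

Lemma coef_comp_scaleX (p : {poly R}) s i : (p \Po (s *: 'X))`_i = s ^+ i * p`_i.
Proof.
rewrite coef_comp_poly.
under eq_bigr => j _ do rewrite exprZn coefZ coefXn.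
have [lt1|ge1] := ltnP i (size p).
  rewrite (bigD1 (Ordinal lt1)) //= eqxx mulr1 mulrC big1 ?addr0 // => j.
  by rewrite -val_eqE /= eq_sym => /negPf ->; rewrite !mulr0.
rewrite [p`_i]nth_default // mulr0 big1 // => j _.
have -> : (i == j :> nat) = false by have := leq_trans (ltn_ord j) ge1; case: ltngtP.
by rewrite !mulr0.
Qed.

End CharPolyReal.

(** * Quadratic forms *)

Section QuadraticForms.
Variable R : realType.

Lemma cvg_sumr (T : Type) (F : set_system T) {FF : Filter F} (I : Type) (r : seq I)
    (P : pred I) (f : I -> T -> R) (l : I -> R) :
  (forall i, P i -> f i x @[x --> F] --> l i) ->
  (\sum_(i <- r | P i) f i x) @[x --> F] --> \sum_(i <- r | P i) l i.
Proof. by move=> h; apply: cvg_big => //; apply: add_continuous. Qed.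

(** Matrices depend on a sequence index through explicit formulas for their
    entries, so convergence is most convenient entry by entry. *)
Definition mx_cvg m n (A : nat -> 'M[R]_(m, n)) (A0 : 'M[R]_(m, n)) :=
  forall i j, (fun k => A k i j) @ \oo --> A0 i j.

Definition qform n (A : 'M[R]_n) (x y : 'rV[R]_n) : R := (x *m A *m y^T) 0 0.

Lemma qformE n (A : 'M[R]_n) x y :
  qform A x y = \sum_j (\sum_i x 0 i * A i j) * y 0 j.
Proof. by rewrite /qform mxE; apply: eq_bigr => j _; rewrite !mxE. Qed.

Lemma qformDl n (A : 'M[R]_n) x y z : qform A (x + y) z = qform A x z + qform A y z.
Proof. by rewrite /qform !mulmxDl mxE. Qed.
Lemma qformZl n (A : 'M[R]_n) a x z : qform A (a *: x) z = a * qform A x z.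
Proof. by rewrite /qform -!scalemxAl mxE. Qed.
Lemma qformDr n (A : 'M[R]_n) x y z : qform A z (x + y) = qform A z x + qform A z y.
Proof. by rewrite /qform linearD mulmxDr mxE. Qed.
Lemma qformZr n (A : 'M[R]_n) a x z : qform A z (a *: x) = a * qform A z x.
Proof. by rewrite /qform linearZ -scalemxAr mxE. Qed.
Lemma qform_tr n (A : 'M[R]_n) x y : qform A^T x y = qform A y x.
Proof.
transitivity ((x *m A^T *m y^T)^T 0 0); first by rewrite [RHS]mxE.
by rewrite !trmx_mul !trmxK mulmxA.
Qed.
Lemma qform_sym n (A : 'M[R]_n) x y : A^T = A -> qform A x y = qform A y x.
Proof. by move=> sA; rewrite -qform_tr sA. Qed.

Lemma qform1 n (x : 'rV[R]_n) : qform 1%:M x x = \sum_i x 0 i ^+ 2.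
Proof. by rewrite /qform mulmx1 mxE; apply: eq_bigr => i _; rewrite mxE expr2. Qed.

Lemma qform1_ge0 n (x : 'rV[R]_n) : 0 <= qform 1%:M x x.
Proof. by rewrite qform1 sumr_ge0 // => i _; rewrite sqr_ge0. Qed.

Lemma qform1_eq0 n (x : 'rV[R]_n) : (qform 1%:M x x == 0) = (x == 0).
Proof.
rewrite qform1 psumr_eq0 => [|i _]; last exact: sqr_ge0.
apply/allP/eqP => [h|-> i _]; last by rewrite mxE expr0n /= eqxx.
apply/rowP => i; rewrite mxE; apply/eqP.
by rewrite -sqrf_eq0; apply: h; rewrite mem_index_enum.
Qed.

Lemma qform1_gt0 n (x : 'rV[R]_n) : x != 0 -> 0 < qform 1%:M x x.
Proof. by move=> x0; rewrite lt_def qform1_eq0 x0 qform1_ge0. Qed.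

(** A nonzero x A would be a descent direction at the minimizer x. *)
Lemma psd_null n (A : 'M[R]_n) (x : 'rV[R]_n) : A^T = A ->
  (forall y, 0 <= qform A y y) -> qform A x x = 0 -> x *m A = 0.
Proof.
move=> sA pA xA.
have h y : qform A x y = 0.
  apply/eqP; apply/negPn/negP => nz.
  set b := qform A x y in nz; set c := qform A y y.
  have c0 : 0 <= c by exact: pA.
  (* The coefficient is chosen to make the form equal to - 1 at this point. *)
  have := pA (y - ((c + 1) / (2 * b)) *: x).
  rewrite -scaleNr !qformDl !qformDr !qformZl !qformZr xA (qform_sym y x) // -/b -/c.
  set t := _ / _; have tb : t * b = (c + 1) / 2 by rewrite /t; field.
  rewrite !mulr0 addr0 mulNr tb; lra.
apply/rowP => i; have := h (delta_mx 0 i).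
by rewrite /qform trmx_delta -colE !mxE.
Qed.

Lemma qform_scalar n a (x y : 'rV[R]_n) : qform a%:M x y = a * qform 1%:M x y.
Proof. by rewrite /qform mul_mx_scalar mulmx1 -scalemxAl mxE. Qed.
Lemma qformDm n (A B : 'M[R]_n) (x y : 'rV[R]_n) : qform (A + B) x y = qform A x y
  + qform B x y.
Proof. by rewrite /qform mulmxDr mulmxDl mxE. Qed.

Lemma qform_continuous n (A : 'M[R]_n) : continuous (fun x : 'rV[R]_n => qform A x x).
Proof.
move=> x; rewrite /continuous_at.
under eq_fun do rewrite qformE; rewrite qformE.
apply: (cvg_sumr (F := nbhs x)) => j _; apply: cvgM; last exact: coord_continuous.
apply: (cvg_sumr (F := nbhs x)) => i _; apply: cvgM; first exact: coord_continuous.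
exact: cvg_cst.
Qed.

(** The form attains its minimum on the compact unit sphere; the inequality
    extends to all vectors by homogeneity. *)
Lemma rayleigh n (A : 'M[R]_n) : (0 < n)%N -> exists (x0 : 'rV[R]_n) (mu : R),
  [/\ x0 != 0, qform A x0 x0 = mu * qform 1%:M x0 x0
  & forall x, mu * qform 1%:M x x <= qform A x x].
Proof.
move=> n0; pose S := [set x : 'rV[R]_n | qform 1%:M x x = 1].
have cS : compact S.
  apply: bounded_closed_compact.
    exists 1; split=> // t t1 x /= xS; apply: le_trans (ltW t1).
    rewrite /Num.norm /= mx_normrE; apply: bigmax_le => // -[i j] _ /=.
    rewrite (ord1 i) -(@ler_pXn2r _ 2) ?nnegrE // expr1n -xS qform1.
    rewrite real_normK ?num_real // (bigD1 j) //= lerDl sumr_ge0 // => k _.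
    exact: sqr_ge0.
  have -> : S = (fun x : 'rV[R]_n => qform 1%:M x x) @^-1` [set 1] by [].
  apply: closed_comp; last exact: closed_eq.
  by move=> x _; apply: qform_continuous.
have S0 : S !=set0.
  exists (delta_mx 0 (Ordinal n0)); rewrite /S /= qform1 (bigD1 (Ordinal n0)) //=.
  rewrite mxE !eqxx expr1n big1 ?addr0 // => i ne; rewrite mxE (negPf ne) andbF.
  by rewrite expr0n.
have cA : {within S, continuous (fun x : 'rV[R]_n => qform A x x)}.
  apply: continuous_subspaceT; exact: qform_continuous.
have [x0 /[!inE] x0S minx] := EVT_min_rV S0 cS cA.
exists x0, (qform A x0 x0); split.
- by rewrite -qform1_eq0 x0S oner_eq0.
- by rewrite x0S mulr1.
move=> x; have [->|xn0] := eqVneq x 0.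
  by rewrite /qform !mul0mx !mxE mulr0.
have q0 := qform1_gt0 xn0; set q := qform 1%:M x x in q0 *.
have s0 : 0 < Num.sqrt q by rewrite sqrtr_gt0.
have : qform A x0 x0 <= qform A ((Num.sqrt q)^-1 *: x) ((Num.sqrt q)^-1 *: x).
  apply: minx; rewrite inE /S /= qformZl qformZr -/q mulrA -invfM -expr2.
  by rewrite sqr_sqrtr ?(ltW q0) // mulVf ?gt_eqF.
rewrite qformZl qformZr mulrA -invfM -expr2 sqr_sqrtr ?(ltW q0) //.
by rewrite ler_pdivlMl // mulrC.
Qed.

Lemma posdef_bound n (A : 'M[R]_n) : (forall x : 'rV[R]_n, x != 0 -> 0 < qform A x x) ->
  exists2 c, 0 < c & forall x, c * qform 1%:M x x <= qform A x x.
Proof.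
case: n A => [A _|n A pA].
  exists 1 => // x; rewrite mul1r /qform; by rewrite !mxE !big_ord0.
have [x0 [mu [x00 e le]]] := rayleigh A (ltn0Sn n).
exists mu => //; have := pA _ x00; rewrite e pmulr_lgt0 //; exact: qform1_gt0.
Qed.

(** The form of A - mu, with mu the minimum of the Rayleigh quotient, is
    positive semidefinite and vanishes at the minimizer, which is therefore in
    its kernel. *)
Lemma not_psd_eigenvector n (A : 'M[R]_n) : A^T = A ->
  ~ (forall x : 'rV[R]_n, 0 <= qform A x x) -> exists (x0 : 'rV[R]_n) (mu : R),
  [/\ x0 != 0, mu < 0 & x0 *m A = mu *: x0].
Proof.
case: n A => [A _ []|n A sA nA].
  by move=> x; rewrite /qform !mxE !big_ord0.
have [x0 [mu [x00 e le]]] := rayleigh A (ltn0Sn n).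
exists x0, mu; split=> //.
  rewrite ltNge; apply/negP => mu0; apply: nA => x.
  apply: le_trans (le x); apply: mulr_ge0 => //; exact: qform1_ge0.
suff : x0 *m (A - mu%:M) = 0.
  by rewrite mulmxBr mul_mx_scalar => /eqP; rewrite subr_eq0 => /eqP.
have qE y : qform (A - mu%:M) y y = qform A y y - mu * qform 1%:M y y.
  by rewrite -raddfN qformDm qform_scalar mulNr.
apply: psd_null; rewrite ?qE ?e ?subrr //.
  by rewrite linearB /= sA tr_scalar_mx.
by move=> y; rewrite qE subr_ge0.
Qed.

(** Positive definiteness is an open condition: a definite form dominates
    c |x|^2, and a perturbation with entries below c / (n + 1) cannot
    compensate for it. *)
Lemma posdef_near n (A : nat -> 'M[R]_n) (A0 : 'M[R]_n) :
  mx_cvg A A0 ->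
  (forall x : 'rV[R]_n, x != 0 -> 0 < qform A0 x x) ->
  \forall k \near \oo, forall x : 'rV[R]_n, x != 0 -> 0 < qform (A k) x x.
Proof.
move=> cA /posdef_bound [c c0 bd].
pose d := c / (n.+1%:R).
have d0 : 0 < d by rewrite divr_gt0.
have : \forall k \near \oo, forall ij : 'I_n * 'I_n, `|A0 ij.1 ij.2 - A k ij.1 ij.2| < d.
  apply: filter_forall => -[i j] /=; by have /cvgrPdist_lt := cA i j; apply.
apply: filterS => k hk x xn0.
have -> : A k = A0 + (A k - A0) by rewrite addrC subrK.
have x1 := qform1_gt0 xn0.
suff h : `|qform (A k - A0) x x| <= d * n%:R * qform 1%:M x x.
  rewrite qformDm -ltrBlDr sub0r.
  apply: le_lt_trans (ler_norm _) _; rewrite normrN (le_lt_trans h) //.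
  apply: lt_le_trans (bd x); rewrite ltr_pM2r // /d mulrAC ltr_pdivrMr //.
  by rewrite ltr_pM2l // ltr_nat.
rewrite qformE; apply: le_trans (ler_norm_sum _ _ _) _.
have -> : d * n%:R * qform 1%:M x x = 
   \sum_(j < n) \sum_(i < n) (d * ((x 0 i ^+ 2 + x 0 j ^+ 2) / 2)).
  under eq_bigr do rewrite -mulr_sumr -mulr_suml big_split /= sumr_const card_ord.
  rewrite -mulr_sumr -mulr_suml big_split /= -qform1.
  by rewrite sumr_const card_ord sumrMnl -qform1 -mulr_natl; field.
apply: ler_sum => j _; rewrite mulr_suml; apply: le_trans (ler_norm_sum _ _ _) _.
apply: ler_sum => i _; rewrite mulrAC [x 0 i * x 0 j * _]mulrC normrM ler_pM //.
  rewrite !mxE distrC; exact: ltW (hk (i, j)).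
rewrite ler_norml; apply/andP; split.
  have := sqr_ge0 (x 0 i + x 0 j); nra.
have := sqr_ge0 (x 0 i - x 0 j); nra.
Qed.
End QuadraticForms.

(** * Krein's argument and convergence of spectra *)

Section Krein.
Variable R : realType.

(** Let v = x + i y be an eigenvector for z and S = M J.  Evaluating S on x and
    y gives S(x, x) + S(y, y) = 2 Im z J(x, y), and the symmetry of S gives
    Re z J(x, y) = 0.  If Re z != 0, then S vanishes on x and on y, so both are
    multiples of [e] and lie in the kernel of M, whence z = 0.  Definiteness is
    only asked for on the orthogonal of the degenerate direction [e]. *)
Lemma krein n (M J : 'M[R]_n) (e : 'rV[R]_n) (z : R[i]) :
  J^T = - J -> (M *m J)^T = M *m J -> e *m M = 0 ->
  (forall x : 'rV[R]_n, x != 0 -> qform 1%:M x e = 0 -> 0 < qform (M *m J) x x) ->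
  root (char_poly (map_mx (real_complex R) M)) z -> z != 0 -> complex.Re z = 0.
Proof.
move=> aJ sS eM pos; rewrite -eigenvalue_root_char => /eigenvalueP [v vM v0] z0.
have eS y : qform (M *m J) e y = 0 by rewrite /qform mulmxA eM !mul0mx mxE.
have psd x : 0 <= qform (M *m J) x x /\ (qform (M *m J) x x = 0 -> x *m M = 0).
  have [c xc] : exists c, qform 1%:M (x - c *: e) e = 0.
    have [->|e0] := eqVneq e 0.
      by exists 0; rewrite scaler0 subr0 /qform trmx0 mulmx0 mxE.
    exists (qform 1%:M x e / qform 1%:M e e).
    by rewrite -scaleNr qformDl qformZl mulNr divfK ?qform1_eq0 // subrr.
  set y := x - c *: e in xc; have -> : x = y + c *: e by rewrite subrK.
  move: y xc => y xc.
  rewrite !qformDl !qformDr !qformZl !qformZr.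
  rewrite (qform_sym y e sS) !eS !(mulr0, addr0).
  have [->|y0] := eqVneq y 0.
    by rewrite /qform !mul0mx mxE; split=> // _; rewrite add0r -scalemxAl eM scaler0.
  by have h := pos _ y0 xc; split; [exact: ltW|move=> h0; rewrite h0 ltxx in h].
pose x : 'rV[R]_n := map_mx (@complex.Re R) v.
pose y : 'rV[R]_n := map_mx (@complex.Im R) v.
set a := complex.Re z; set b := complex.Im z.
have ez : z = Complex a b by rewrite /a /b; case: (z).
have ReM i : complex.Re ((v *m map_mx (real_complex R) M) 0 i) = (x *m M) 0 i.
  rewrite !mxE raddf_sum; apply: eq_bigr => j _; rewrite !mxE.
  by case: (v 0 j) => p q /=; rewrite mulr0 subr0.
have ImM i : complex.Im ((v *m map_mx (real_complex R) M) 0 i) = (y *m M) 0 i.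
  rewrite !mxE raddf_sum; apply: eq_bigr => j _; rewrite !mxE.
  by case: (v 0 j) => p q /=; rewrite mulr0 add0r mulrC.
have xM : x *m M = a *: x - b *: y.
  by apply/rowP => i; rewrite -ReM vM !mxE ez; case: (v 0 i).
have yM : y *m M = b *: x + a *: y.
  by apply/rowP => i; rewrite -ImM vM !mxE ez; case: (v 0 i) => p q /=; rewrite addrC.
have J0 u : qform J u u = 0.
  have : qform J u u = - qform J u u.
    by rewrite -{1}qform_tr aJ /qform mulmxN mulNmx mxE.
  lra.
have JN u w : qform J u w = - qform J w u.
  by rewrite -qform_tr aJ /qform mulmxN mulNmx mxE.
have MJ u w : qform (M *m J) u w = qform J (u *m M) w by rewrite /qform mulmxA.
have sxy : qform (M *m J) x y = qform (M *m J) y x by exact: qform_sym.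
move: sxy; rewrite !MJ xM yM -scaleNr !qformDl !qformZl !J0 (JN y x) => sxy.
have Qx : qform (M *m J) x x = b * qform J x y.
  by rewrite MJ xM -scaleNr qformDl !qformZl J0 (JN y x); ring.
have Qy : qform (M *m J) y y = b * qform J x y.
  by rewrite MJ yM qformDl !qformZl J0; ring.
have /eqP : a * qform J x y = 0 by lra.
rewrite mulf_eq0 => /orP[/eqP //|/eqP w0].
rewrite w0 mulr0 in Qx Qy.
have xM0 := (psd x).2 Qx; have yM0 := (psd y).2 Qy.
case/negP: v0; apply/eqP.
have vM0 : z *: v = 0.
  rewrite -vM; apply/rowP => i; rewrite [RHS]mxE.
  have := ReM i; have := ImM i; rewrite xM0 yM0 !mxE.
  by case: (\sum_j _) => p q /= -> ->.
by move/eqP: vM0; rewrite scaler_eq0 (negPf z0) => /eqP.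
Qed.

Lemma cvg_coef_char_poly n (A : nat -> 'M[R]_n) (A0 : 'M[R]_n) :
  mx_cvg A A0 ->
  forall m, (fun k => (char_poly (A k))`_m) @ \oo --> (char_poly A0)`_m.
Proof.
move=> cA.
pose pc (p : nat -> {poly R}) (p0 : {poly R}) := forall m, (fun k => (p k)`_m) @ \oo
  --> p0`_m.
have pcc p : pc (fun=> p) p by move=> m; exact: cvg_cst.
have pcD p p0 q q0 : pc p p0 -> pc q q0 -> pc (fun k => p k + q k) (p0 + q0).
  by move=> hp hq m; under eq_fun do rewrite coefD; rewrite coefD; apply: cvgD.
have pcM p p0 q q0 : pc p p0 -> pc q q0 -> pc (fun k => p k * q k) (p0 * q0).
  move=> hp hq m; under eq_fun do rewrite coefM; rewrite coefM.
  by apply: cvg_sumr => i _; apply: cvgM.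
have pcE i j : pc (fun k => char_poly_mx (A k) i j) (char_poly_mx A0 i j).
  move=> m; under eq_fun do rewrite !mxE coefD coefN coefC.
  rewrite !mxE coefD coefN coefC; apply: cvgD; first exact: cvg_cst.
  by apply: cvgN; case: ifP => _; [exact: cA|exact: cvg_cst].
rewrite -/(pc (fun k => char_poly (A k)) (char_poly A0)).
rewrite /char_poly /determinant.
have pcsum (I : finType) (f : I -> nat -> {poly R}) f0 : (forall i, pc (f i) (f0 i)) ->
    pc (fun k => \sum_i f i k) (\sum_i f0 i).
  move=> hf m; under eq_fun do rewrite coef_sum; rewrite coef_sum.
  by apply: cvg_sumr => i _; exact: hf.
have pcprod (I : finType) (f : I -> nat -> {poly R}) f0 : (forall i, pc (f i) (f0 i)) ->
    pc (fun k => \prod_i f i k) (\prod_i f0 i).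
  move=> hf; rewrite /index_enum; elim: (Finite.enum I) => [|i r IH].
    by under eq_fun do rewrite big_nil; rewrite big_nil; exact: pcc.
  by under eq_fun do rewrite big_cons; rewrite big_cons; exact: pcM.
apply: pcsum => s; apply: pcM; first exact: pcc.
by apply: pcprod => i; exact: pcE.
Qed.

Lemma cvg_horner_char_poly n (A : nat -> 'M[R]_n) (A0 : 'M[R]_n) x :
  mx_cvg A A0 ->
  (fun k => (char_poly (A k)).[x]) @ \oo --> (char_poly A0).[x].
Proof.
move=> cA.
have hE (B : 'M[R]_n) : (char_poly B).[x] = \sum_(i < n.+1) (char_poly B)`_i * x ^+ i.
  by apply: horner_coef_wide; rewrite size_char_poly.
under eq_fun do rewrite hE; rewrite hE; apply: cvg_sumr => i _.
by apply: cvgM; [exact: cvg_coef_char_poly|exact: cvg_cst].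
Qed.
End Krein.

(** * Spectral stability near the limit *)

Section LimitSystem.
Variable R : realType.

(** Linear stability as a property of the matrix alone. *)
Definition spectrally_stable n (L : 'M[R]_n) : Prop :=
  exists s : seq R[i],
    char_poly (map_mx (real_complex R) L) = 'X^2 * \prod_(z <- s) ('X - z%:P)
    /\ (forall z, z \in s -> complex.Re z = 0 /\ z != 0).

Lemma norm_real_complex (a : R) : `|real_complex R a| = real_complex R `|a|.
Proof. by rewrite normc_def /= expr0n addr0 sqrtr_sqr. Qed.

(** Each imaginary root is at distance at least x from x >= 0.  This closed
    condition passes to the limit of characteristic polynomials, which spares
    the continuity of roots. *)
Lemma spectrally_stable_lower_bound n (L : 'M[R]_n) (x : R) :
  spectrally_stable L -> 0 <= x -> x ^+ n <= `|(char_poly L).[x]|.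
Proof.
move=> [s [e hs]] x0.
have sz : n = (size s).+2.
  have := size_char_poly (map_mx (real_complex R) L).
  rewrite e size_monicM ?monicXn ?monic_neq0 ?monic_prod_XsubC //.
  by rewrite size_polyXn size_prod_XsubC /= !addSn add0n => -[->].
suff : (real_complex R x) ^+ n
    <= `|(char_poly (map_mx (real_complex R) L)).[real_complex R x]|.
  by rewrite -map_char_poly horner_map /= norm_real_complex -rmorphXn lecR.
have xC : 0 <= real_complex R x by rewrite (lecR 0).
rewrite e hornerM hornerXn normrM normrX norm_real_complex (ger0_norm x0).
rewrite sz -addn2 addnC exprD ler_wpM2l ?exprn_ge0 //.
elim: s {e sz} hs => [|z s IH] hs; first by rewrite big_nil hornerC normr1.
rewrite big_cons hornerM hornerXsubC normrM exprS ler_pM ?exprn_ge0 //; last first.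
  by apply: IH => w ws; apply: hs; rewrite inE ws orbT.
have [Rz _] := hs z (mem_head _ _); rewrite normc_def lecR.
move: Rz; case: (z) => a b /= ->; rewrite subr0 -{1}(ger0_norm x0) -sqrtr_sqr.
by rewrite ler_wsqrtr // lerDl sqr_ge0.
Qed.

Lemma spectrally_stable_of_roots n (L : 'M[R]_n) :
  'X^2 %| char_poly L -> (char_poly L)`_2 != 0 ->
  (forall z, root (char_poly (map_mx (real_complex R) L)) z -> z != 0 ->
    complex.Re z = 0) ->
  spectrally_stable L.
Proof.
move=> /dvdpP[q eq] c2 roots.
have q0 : q`_0 != 0 by move: c2; rewrite eq coefMXn.
pose qc := map_poly (real_complex R) q.
have epc : char_poly (map_mx (real_complex R) L) = 'X^2 * qc.
  by rewrite -map_char_poly eq rmorphM /= map_polyXn mulrC.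
have mq : qc \is monic.
  by have := char_poly_monic (map_mx (real_complex R) L); rewrite epc monicMl // monicXn.
have [s es] := closed_field_poly_normal qc.
rewrite (monicP mq) scale1r in es.
exists s; split; first by rewrite epc es.
move=> z zs; have rz : root qc z by rewrite es root_prod_XsubC.
have z0 : z != 0.
  apply: contraNneq q0 => z0; move: rz; rewrite z0 /root horner_coef0 coef_map /=.
  by rewrite fmorph_eq0.
by split=> //; apply: roots => //; rewrite epc rootM rz orbT.
Qed.

Lemma mup1_coef (p : {poly R}) : p != 0 -> mup 0 p = 1%N -> p`_0 = 0 /\ p`_1 != 0.
Proof.
move=> p0 m1.
have /dvdXnP h1 : 'X^1 %| p by rewrite -dvdXn_mup // m1.
split; first exact: h1.
apply/negP => /eqP p1; have : 'X^2 %| p by apply/dvdXnP => -[|[|i]] // _; exact: h1.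
by rewrite -dvdXn_mup // m1.
Qed.

Lemma mup2_of_coef (p : {poly R}) : 'X^2 %| p -> p`_2 != 0 -> mup 0 p = 2%N.
Proof.
move=> d2 c2; have p0 : p != 0 by apply: contraNneq c2 => ->; rewrite coef0.
apply/eqP; rewrite eqn_leq dvdXn_mup // d2 andbT leqNgt dvdXn_mup //.
by apply/negP => /dvdXnP /(_ 2%N isT) /eqP; rewrite (negPf c2).
Qed.

Lemma simple_kernel n (H : 'M[R]_n) : (char_poly H)`_0 = 0 -> (char_poly H)`_1 != 0 ->
  \rank (kermx H) = 1%N.
Proof.
move=> c0 c1; have /dvdXnP h := Xn_dvd_char_poly H.
apply/eqP; rewrite eqn_leq mxrank_ker; apply/andP; split.
  by rewrite leqNgt; apply/negP => lt; move: c1; rewrite h ?eqxx.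
rewrite -mxrank_ker lt0n mxrank_eq0.
have : eigenvalue H 0 by rewrite eigenvalue_root_char /root horner_coef0 c0.
by rewrite /eigenvalue /eigenspace raddf0 subr0.
Qed.

Lemma kernel_span n (H : 'M[R]_n) (u v : 'rV[R]_n) : \rank (kermx H) = 1%N ->
  u *m H = 0 -> u != 0 -> v *m H = 0 -> exists c, v = c *: u.
Proof.
move=> rk uH u0 vH.
have uK : (u <= kermx H)%MS by apply/sub_kermxP.
have vK : (v <= kermx H)%MS by apply/sub_kermxP.
have : (u == kermx H)%MS.
  by rewrite -(mxrank_leqif_eq uK) rk rank_rV u0.
by case/andP => _ Ku; have /sub_rVP := submx_trans vK Ku.
Qed.

Section Limit.
Variables (N : nat) (sg : R) (H : 'M[R]_N).
Hypotheses (N0 : (0 < N)%N) (sg2 : sg * sg = 1) (Hs : H^T = H).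
Hypotheses (H1 : const_mx 1 *m H = 0 :> 'rV[R]_N) (cH : (char_poly H)`_1 != 0).
Variables (M J : nat -> 'M[R]_(N + N)).
Hypothesis cM : mx_cvg M (block_mx 0 (- 2)%:M (sg *: H) 0).
Hypothesis cJ : mx_cvg J (block_mx 0 1%:M (- 1)%:M 0).

Let sg0 : sg != 0.
Proof. by apply: contra_eq_neq sg2 => ->; rewrite mul0r eq_sym oner_eq0. Qed.

Lemma limit_coef2 : \forall k \near \oo, (char_poly (M k))`_2 != 0.
Proof.
have c := @cvg_coef_char_poly _ _ _ _ cM 2%N.
have n0 : (char_poly (block_mx 0 (- 2)%:M (sg *: H) 0 : 'M[R]_(N + N)))`_2 != 0.
  rewrite coef2_char_poly_antidiag !mulf_neq0 ?expf_neq0 ?oppr_eq0 ?invr_eq0 //.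
  have h : 1%:M *m (sg *: H) = sg *: (H *m 1%:M) by rewrite mul1mx mulmx1.
  have /(congr1 (fun p : {poly R} => p`_1)) := char_poly_scaled_similar (unitmx1 _ _) h.
  rewrite coef_comp_scaleX coefZ expr1 => e.
  by have : sg * (char_poly (sg *: H))`_1 != 0;
    [rewrite e mulf_neq0 ?expf_neq0|rewrite mulf_eq0 negb_or => /andP[]].
exact: cvgr_neq0 c n0.
Qed.

Definition rotation_vector : 'rV[R]_(N + N) := row_mx 0 (const_mx 1).

(** In the limit S = M J is [2, 0; 0, sg H], which is positive semidefinite with
    kernel spanned by the rotation vector e; adding e^T e makes it definite,
    hence definite for large k, and e^T e vanishes on the orthogonal of e. *)
Lemma limit_stable : (forall x : 'rV[R]_N, 0 <= qform (sg *: H) x x) ->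
  \forall k \near \oo, (J k)^T = - J k -> (M k *m J k)^T = M k *m J k ->
    rotation_vector *m M k = 0 ->
    forall z, root (char_poly (map_mx (real_complex R) (M k))) z -> z != 0 ->
      complex.Re z = 0.
Proof.
move=> psd; pose e := rotation_vector.
pose S0 : 'M[R]_(N + N) := block_mx 2%:M 0 0 (sg *: H).
have cS : mx_cvg (fun k => M k *m J k + e^T *m e) (S0 + e^T *m e).
  move=> i j.
  have -> : S0 = block_mx 0 (- 2)%:M (sg *: H) 0 *m block_mx 0 1%:M (- 1)%:M 0.
    rewrite mulmx_block !mul0mx !mulmx0 !mulmx1 !addr0 !add0r mul_scalar_mx.
    by rewrite scale_scalar_mx mulrNN mulr1.
  rewrite mxE; under eq_fun do rewrite mxE.
  apply: cvgD; last exact: cvg_cst.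
  rewrite mxE; under eq_fun do rewrite mxE.
  by apply: cvg_sumr => l _; apply: cvgM.
have qe (S : 'M[R]_(N + N)) x :
    qform (S + e^T *m e) x x = qform S x x + qform 1%:M x e ^+ 2.
  rewrite qformDm; congr (_ + _).
  have h : e *m x^T = (x *m e^T)^T by rewrite trmx_mul trmxK.
  by rewrite /qform mulmx1 mulmxA -mulmxA h mxE big_ord1 [(_^T) 0 0]mxE expr2.
have pos x : x != 0 -> 0 < qform (S0 + e^T *m e) x x.
  move=> x0; rewrite qe.
  have xE : x = row_mx (lsubmx x) (rsubmx x) by rewrite hsubmxK.
  set a := lsubmx x in xE; set b := rsubmx x in xE.
  have -> : qform S0 x x = 2 * qform 1%:M a a + qform (sg *: H) b b.
    rewrite xE /qform tr_row_mx mul_row_block !mulmx0 addr0 add0r mul_row_col mxE.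
    by rewrite mul_mx_scalar mulmx1 -scalemxAl mxE.
  have -> : qform 1%:M x e = \sum_i b 0 i.
    rewrite xE /qform mulmx1 tr_row_mx mul_row_col trmx0 mulmx0 add0r mxE.
    by apply: eq_bigr => i _; rewrite !mxE mulr1.
  have a0 := qform1_ge0 a; have b0 := psd b; have s0 := sqr_ge0 (\sum_i b 0 i).
  rewrite lt_def; apply/andP; split; last by lra.
  apply: contraNneq x0 => e0.
  have qa : qform 1%:M a a == 0 by apply/eqP; lra.
  have qb : qform (sg *: H) b b = 0 by lra.
  have sb : \sum_i b 0 i = 0 by apply/eqP; rewrite -sqrf_eq0; apply/eqP; lra.
  rewrite qform1_eq0 in qa; rewrite xE (eqP qa).
  have bH : b *m H = 0.
    have := psd_null _ psd qb; rewrite linearZ /= Hs => /(_ erefl) /eqP.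
    by rewrite -scalemxAr scaler_eq0 (negPf sg0) => /eqP.
  have rk : \rank (kermx H) = 1%N.
    apply: simple_kernel => //.
    have : root (char_poly H) 0.
      rewrite -eigenvalue_root_char; apply/eigenvalueP; exists (const_mx 1).
        by rewrite scale0r.
      by apply/eqP => /rowP /(_ (Ordinal N0)) /eqP; rewrite !mxE oner_eq0.
    by rewrite /root horner_coef0 => /eqP.
  have c10 : const_mx 1 != 0 :> 'rV[R]_N.
    by apply/eqP => /rowP /(_ (Ordinal N0)) /eqP; rewrite !mxE oner_eq0.
  have [c bc] := kernel_span rk H1 c10 bH.
  move: sb; rewrite bc; under eq_bigr do rewrite !mxE mulr1.
  rewrite sumr_const card_ord => /eqP; rewrite mulrn_eq0 eqn0Ngt N0 /= => /eqP ->.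
  by rewrite scale0r row_mx0.
apply: filterS (posdef_near cS pos) => k posk aJ sS eM z.
apply: krein aJ sS eM _ => x x0 xe.
by have := posk x x0; rewrite qe xe expr0n addr0.
Qed.

(** A negative eigenvalue d of sg H makes sqrt (- 2 d) a real eigenvalue of the
    limit matrix. *)
Lemma limit_unstable : ~ (forall x : 'rV[R]_N, 0 <= qform (sg *: H) x x) ->
  exists2 x, 0 < x & \forall k \near \oo, `|(char_poly (M k)).[x]| < x ^+ (N + N).
Proof.
move=> npsd.
have sK : (sg *: H)^T = sg *: H by rewrite linearZ /= Hs.
have [b [d [b0 d0 bH]]] := not_psd_eigenvector sK npsd.
pose x := Num.sqrt (- 2 * d).
have x2 : x ^+ 2 = - 2 * d by rewrite sqr_sqrtr //; nra.
have x0 : 0 < x by rewrite sqrtr_gt0; nra.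
exists x => //.
have r : (char_poly (block_mx 0 (- 2)%:M (sg *: H) 0 : 'M[R]_(N + N))).[x] = 0.
  apply/eqP; rewrite -/(root _ _) -eigenvalue_root_char; apply/eigenvalueP.
  exists (row_mx (- (x / 2) *: b) b); last first.
    by rewrite -row_mx0; apply: contraNneq b0 => /eq_row_mx [_ ->].
  rewrite mul_row_block !mulmx0 addr0 add0r bH mul_mx_scalar scale_row_mx !scalerA.
  congr row_mx; congr (_ *: _); last by field.
  by rewrite mulrN mulrA -expr2 x2; field.
have := cvg_horner_char_poly (x := x) cM; rewrite r => /cvgr0_norm_lt; apply.
by rewrite exprn_gt0.
Qed.
End Limit.
End LimitSystem.

(** * Rescaling a slow-fast linearization *)

Section Rescaling.
Variables (R : realType) (N : nat).

(** The shape of the linearization and of the symplectic matrix in the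
    coordinates (radii, angles): only the blocks that carry the factor [e]
    disappear as e -> 0. *)
Definition slow_fast_mx e (A U B D : 'M[R]_N) : 'M[R]_(N + N) :=
  block_mx (e *: A) U (e *: B) (e *: D).
Definition slow_fast_form e (P Q T V : 'M[R]_N) : 'M[R]_(N + N) :=
  block_mx P Q T (e *: V).

(** For e = sg s^2, these are the matrices above after the angles and the time
    have been multiplied by s; the form is also multiplied by s.  In the
    limit, the block [sg *: B] is now of the same order as [U]. *)
Definition rescaled_mx sg s (A U B D : 'M[R]_N) : 'M[R]_(N + N) :=
  block_mx ((sg * s) *: A) U (sg *: B) ((sg * s) *: D).
Definition rescaled_form sg s (P Q T V : 'M[R]_N) : 'M[R]_(N + N) :=
  block_mx (s *: P) Q T ((sg * s) *: V).

Section Fixed.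
Variables (sg s : R) (A U B D P Q T V : 'M[R]_N).
Hypothesis s_gt0 : 0 < s.
Let L := slow_fast_mx (sg * (s * s)) A U B D.
Let W := slow_fast_form (sg * (s * s)) P Q T V.
Let M := rescaled_mx sg s A U B D.
Let J := rescaled_form sg s P Q T V.
Let G : 'M[R]_(N + N) := block_mx 1%:M 0 0 s^-1%:M.

Let s_neq0 : s != 0. Proof. by rewrite gt_eqF. Qed.

Let unitG : G \in unitmx.
Proof.
by rewrite unitmxE det_ublock det1 mul1r det_scalar unitfE expf_neq0 // invr_eq0.
Qed.

Let GL : G *m L = s *: (M *m G).
Proof.
rewrite !mulmx_block scale_block_mx !mul0mx !mulmx0 !mul1mx !mulmx1 !add0r !addr0.
rewrite !mul_mx_scalar !mul_scalar_mx !scalerA.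
by congr block_mx; congr (_ *: _) || (rewrite -[LHS]scale1r; congr (_ *: _)); field.
Qed.

Let JG : J = s *: (G *m W *m G).
Proof.
rewrite !mulmx_block scale_block_mx !mul0mx !mulmx0 !mul1mx !mulmx1 !add0r !addr0.
rewrite !mul_mx_scalar !mul_scalar_mx !scalerA.
by congr block_mx; congr (_ *: _) || (rewrite -[LHS]scale1r; congr (_ *: _)); field.
Qed.

Let trG : G^T = G.
Proof. by rewrite tr_block_mx !tr_scalar_mx !trmx0. Qed.

Lemma rescaled_char_poly : char_poly L \Po (s *: 'X) = s ^+ (N + N) *: char_poly M.
Proof. exact: char_poly_scaled_similar unitG GL. Qed.

Lemma rescaled_form_antisym : W^T = - W -> J^T = - J.
Proof.
by move=> aW; rewrite JG linearZ /= !trmx_mul trG aW mulNmx mulmxN scalerN mulmxA.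
Qed.

Lemma rescaled_hamiltonian : (L *m W)^T = L *m W -> (M *m J)^T = M *m J.
Proof.
move=> sLW; have -> : M *m J = G *m (L *m W) *m G.
  transitivity (s *: (M *m G) *m W *m G).
    by rewrite JG -scalemxAr -!scalemxAl; congr (_ *: _); rewrite -!mulmxA.
  by rewrite -GL -!mulmxA.
by rewrite !trmx_mul trG -trmx_mul sLW !mulmxA.
Qed.

Lemma rescaled_rotation : rotation_vector R N *m L = 0 -> rotation_vector R N *m M = 0.
Proof.
move=> rot.
have h : rotation_vector R N *m G = s^-1 *: rotation_vector R N.
  rewrite mul_row_block !mulmx0 !mul0mx addr0 add0r mul_mx_scalar.
  by rewrite scale_row_mx scaler0.
have : s *: (rotation_vector R N *m M *m G) = 0.
  by rewrite -mulmxA scalemxAr -GL mulmxA h -scalemxAl rot scaler0.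
move/eqP; rewrite scaler_eq0 (negPf s_neq0) /= => /eqP h2.
by rewrite -[LHS](mulmxK unitG) h2 mul0mx.
Qed.

Lemma rescaled_coef2 : (char_poly M)`_2 != 0 -> (char_poly L)`_2 != 0.
Proof.
move=> m2; have /(congr1 (fun p : {poly R} => p`_2)) := rescaled_char_poly.
rewrite coef_comp_scaleX coefZ => e.
have : s ^+ 2 * (char_poly L)`_2 != 0 by rewrite e mulf_neq0 ?expf_neq0.
by rewrite mulf_eq0 negb_or => /andP[].
Qed.

Lemma rescaled_horner x :
  (char_poly L).[s * x] = s ^+ (N + N) * (char_poly M).[x].
Proof. by rewrite -hornerZ -rescaled_char_poly horner_comp hornerZ hornerX. Qed.

Lemma rescaled_imaginary_roots :
  (forall z, root (char_poly (map_mx (real_complex R) M)) z -> z != 0 ->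
    complex.Re z = 0) ->
  forall z, root (char_poly (map_mx (real_complex R) L)) z -> z != 0 ->
    complex.Re z = 0.
Proof.
move=> hM z rz z0.
have sC : real_complex R s != 0 by rewrite fmorph_eq0.
have : complex.Re (z / real_complex R s) = 0.
  apply: hM; last by rewrite mulf_neq0 ?invr_eq0.
  have := congr1 (map_poly (real_complex R)) rescaled_char_poly.
  rewrite map_comp_poly map_polyZ /= map_polyX map_polyZ /= !map_char_poly => e.
  have /eqP : real_complex R (s ^+ (N + N)) *
     (char_poly (map_mx (real_complex R) M)).[z / real_complex R s] = 0.
    rewrite -hornerZ -e horner_comp hornerZ hornerX mulrC divfK //; exact/eqP.
  by rewrite mulf_eq0 fmorph_eq0 expf_eq0 (negPf s_neq0) andbF.
case: (z) => a b; rewrite -fmorphV /= !mulr0 subr0 => /eqP.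
by rewrite mulf_eq0 invr_eq0 (negPf s_neq0) orbF => /eqP.
Qed.
End Fixed.

Lemma cvg_block (a b c d : nat -> 'M[R]_N) (a0 b0 c0 d0 : 'M[R]_N) :
  mx_cvg a a0 -> mx_cvg b b0 -> mx_cvg c c0 -> mx_cvg d d0 ->
  mx_cvg (fun k => block_mx (a k) (b k) (c k) (d k)) (block_mx a0 b0 c0 d0).
Proof.
move=> ha hb hc hd i j.
case: (split_ordP i) => i' ->; case: (split_ordP j) => j' ->.
- under eq_fun do rewrite block_mxEul; rewrite block_mxEul; exact: ha.
- under eq_fun do rewrite block_mxEur; rewrite block_mxEur; exact: hb.
- under eq_fun do rewrite block_mxEdl; rewrite block_mxEdl; exact: hc.
- under eq_fun do rewrite block_mxEdr; rewrite block_mxEdr; exact: hd.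
Qed.

Lemma mx_cvgZ (c : nat -> R) (c0 : R) (a : nat -> 'M[R]_N) (a0 : 'M[R]_N) :
  c @ \oo --> c0 -> mx_cvg a a0 -> mx_cvg (fun k => c k *: a k) (c0 *: a0).
Proof.
move=> hc ha i j; under eq_fun do rewrite mxE; rewrite mxE.
by apply: cvgM => //; exact: ha.
Qed.

(** Along the indices where e has a given sign, the whole question is decided
    by the limit of the rescaled matrices. *)
Lemma slow_fast_stability (sg : R) (H : 'M[R]_N) (eps : nat -> R)
    (L W : nat -> 'M[R]_(N + N)) (A U B D P Q T V : nat -> 'M[R]_N)
    (A0 D0 P0 V0 : 'M[R]_N) (r : nat -> 'rV[R]_N) :
  (0 < N)%N -> sg * sg = 1 -> H^T = H -> (const_mx 1 : 'rV[R]_N) *m H = 0 ->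
  (char_poly H)`_1 != 0 -> (forall k, eps k != 0) -> eps @ \oo --> (0 : R) ->
  mx_cvg A A0 -> mx_cvg U (- 2)%:M -> mx_cvg B H -> mx_cvg D D0 ->
  mx_cvg P P0 -> mx_cvg Q 1%:M -> mx_cvg T (- 1)%:M -> mx_cvg V V0 ->
  (forall k, L k = slow_fast_mx (eps k) (A k) (U k) (B k) (D k)) ->
  (forall k, W k = slow_fast_form (eps k) (P k) (Q k) (T k) (V k)) ->
  (forall k, rotation_vector R N *m L k = 0) ->
  (forall k, row_mx (r k) 0 *m L k = - 2 *: rotation_vector R N) ->
  (forall k, (W k)^T = - W k) -> (forall k, (L k *m W k)^T = L k *m W k) ->
  \forall k \near \oo, eps k = sg * `|eps k| ->
    mup 0 (char_poly (L k)) = 2%N /\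
    (spectrally_stable (L k) <-> forall x : 'rV[R]_N, 0 <= qform (sg *: H) x x).
Proof.
move=> N0 sg2 Hs H1 cH eps0 cvg_eps cA cU cB cD cP cQ cT cV LE WE rot dil aW sLW.
pose s k := Num.sqrt `|eps k|.
have s0 k : 0 < s k by rewrite sqrtr_gt0 normr_gt0.
have ss k : s k * s k = `|eps k| by rewrite -expr2 sqr_sqrtr.
have cvg_s : s @ \oo --> (0 : R).
  rewrite -[0]sqrtr0.
  apply: (cvg_comp (fun k => `|eps k|) Num.sqrt); last exact: sqrt_continuous.
  by rewrite -(@normr0 _ R); apply: cvg_norm.
pose M k := rescaled_mx sg (s k) (A k) (U k) (B k) (D k).
pose J k := rescaled_form sg (s k) (P k) (Q k) (T k) (V k).
have cvg_sgs : (fun k => sg * s k) @ \oo --> sg * 0.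
  by apply: cvgM; [exact: cvg_cst|].
have cM : mx_cvg M (block_mx 0 (- 2)%:M (sg *: H) 0).
  apply: cvg_block => //.
  - by rewrite -(scale0r A0) -(mulr0 sg); exact: mx_cvgZ.
  - by apply: mx_cvgZ => //; exact: cvg_cst.
  - by rewrite -(scale0r D0) -(mulr0 sg); exact: mx_cvgZ.
have cJ : mx_cvg J (block_mx 0 1%:M (- 1)%:M 0).
  apply: cvg_block => //.
  - by rewrite -(scale0r P0); exact: mx_cvgZ.
  - by rewrite -(scale0r V0) -(mulr0 sg); exact: mx_cvgZ.
have X2L k : 'X^2 %| char_poly (L k).
  apply: (X2_dvd_char_poly (c := - 2)) (rot k) (dil k); last by rewrite oppr_eq0.
  apply/eqP => /rowP /(_ (rshift N (Ordinal N0))) /eqP.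
  by rewrite row_mxEr !mxE oner_eq0.
have LE' k : eps k = sg * `|eps k| ->
    L k = slow_fast_mx (sg * (s k * s k)) (A k) (U k) (B k) (D k).
  by move=> e; rewrite ss -e LE.
have WE' k : eps k = sg * `|eps k| ->
    W k = slow_fast_form (sg * (s k * s k)) (P k) (Q k) (T k) (V k).
  by move=> e; rewrite ss -e WE.
have nd := limit_coef2 sg2 cH cM.
have mupL k : eps k = sg * `|eps k| -> (char_poly (M k))`_2 != 0 ->
    mup 0 (char_poly (L k)) = 2%N.
  move=> /LE' Lk c2; apply: mup2_of_coef; first exact: X2L.
  by rewrite Lk; exact: rescaled_coef2.
have [psd|npsd] := pselect (forall x : 'rV[R]_N, 0 <= qform (sg *: H) x x).
  have st := limit_stable N0 sg2 Hs H1 cH cM cJ psd.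
  near=> k => sk.
  have c2 : (char_poly (M k))`_2 != 0 by near: k.
  split; first exact: mupL.
  split=> // _; have Lk := LE' k sk; have Wk := WE' k sk.
  apply: spectrally_stable_of_roots; first exact: X2L.
    by rewrite Lk; exact: rescaled_coef2.
  rewrite Lk; apply: rescaled_imaginary_roots => //.
  have : (J k)^T = - J k -> (M k *m J k)^T = M k *m J k ->
    rotation_vector R N *m M k = 0 ->
    forall z, root (char_poly (map_mx (real_complex R) (M k))) z -> z != 0 ->
      complex.Re z = 0 by near: k.
  apply.
  - by apply: rescaled_form_antisym => //; rewrite -Wk.
  - by apply: rescaled_hamiltonian => //; rewrite -Wk -Lk.
  - by apply: rescaled_rotation => //; rewrite -Lk.
have [x x0 un] := limit_unstable Hs cM npsd.
near=> k => sk.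
have c2 : (char_poly (M k))`_2 != 0 by near: k.
split; first exact: mupL.
split=> // st.
have : `|(char_poly (M k)).[x]| < x ^+ (N + N) by near: k.
have := spectrally_stable_lower_bound (x := s k * x) st.
rewrite mulr_ge0 ?(ltW (s0 k)) ?(ltW x0) // => /(_ isT).
rewrite (LE' k sk) rescaled_horner // normrM exprMn.
rewrite (ger0_norm (exprn_ge0 _ (ltW (s0 k)))).
by rewrite ler_pM2l ?exprn_gt0 // leNgt => /negP.
Unshelve. all: by end_near. Qed.
End Rescaling.

(** * Directional derivatives and the Hessian of the potential *)

Section DD.
Context {R : realType} {V : normedModType R}.
(** Differentiability and the value of one directional derivative are carried
    together, so that a single traversal of a formula proves both. *)
Definition has_dd (f : V -> R) (x v : V) (d : R) := differentiable f x /\ 'd f x v = d.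

Lemma has_dd_eq f x v d d' : has_dd f x v d -> d = d' -> has_dd f x v d'.
Proof. by move=> h <-. Qed.
Lemma has_dd_cst (c : R) x v : has_dd (fun=> c) x v 0.
Proof. by split; [exact: differentiable_cst|rewrite (diff_cst c x)]. Qed.
Lemma has_ddD f g x v a b : has_dd f x v a -> has_dd g x v b ->
  has_dd (fun y => f y + g y) x v (a + b).
Proof.
move=> [df <-] [dg <-]; split; first exact: differentiableD.
by rewrite (diffD df dg).
Qed.
Lemma has_ddN f x v a : has_dd f x v a -> has_dd (fun y => - f y) x v (- a).
Proof. by move=> [df <-]; split; [exact: differentiableN|rewrite (diffN df)]. Qed.
Lemma has_ddB f g x v a b : has_dd f x v a -> has_dd g x v b ->
  has_dd (fun y => f y - g y) x v (a - b).
Proof. by move=> ha hb; apply: has_ddD => //; apply: has_ddN. Qed.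
Lemma has_ddM f g x v a b : has_dd f x v a -> has_dd g x v b ->
  has_dd (fun y => f y * g y) x v (f x * b + g x * a).
Proof.
move=> [df <-] [dg <-]; split; first exact: differentiableM.
by rewrite (diffM df dg).
Qed.
Lemma has_ddV f x v a : f x != 0 -> has_dd f x v a ->
  has_dd (fun y => (f y)^-1) x v (- (f x) ^- 2 * a).
Proof.
move=> f0 [df <-]; split; first exact: differentiableV.
by rewrite (diffV df f0).
Qed.
Lemma has_dd_sum (I : finType) (P : pred I) (f : I -> V -> R) x v a :
  (forall i, P i -> has_dd (f i) x v (a i)) ->
  has_dd (fun y => \sum_(i | P i) f i y) x v (\sum_(i | P i) a i).
Proof.
move=> h; rewrite /index_enum; elim: (Finite.enum I) => [|i s IH].
  rewrite big_nil; under eq_fun do rewrite big_nil; exact: has_dd_cst.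
rewrite big_cons; under eq_fun do rewrite big_cons.
by case: ifP => // Pi; apply: has_ddD => //; apply: h.
Qed.
Lemma has_dd_comp (g : R -> R) (f : V -> R) x v a b :
  is_derive (f x) 1 g b -> has_dd f x v a -> has_dd (fun y => g (f y)) x v (a * b).
Proof.
move=> [dg gb] [df <-].
have dg' : differentiable g (f x) by apply/derivable1_diffP.
split; first exact: differentiable_comp.
by rewrite (diff_comp df dg') /= (deriv1E dg) derive1E gb.
Qed.
Lemma has_dd_cos f x v a : has_dd f x v a ->
  has_dd (fun y => cos (f y)) x v (- sin (f x) * a).
Proof. by move=> h; rewrite mulrC; apply: has_dd_comp. Qed.
Lemma has_dd_sin f x v a : has_dd f x v a ->
  has_dd (fun y => sin (f y)) x v (cos (f x) * a).
Proof. by move=> h; rewrite mulrC; apply: has_dd_comp. Qed.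
Lemma has_dd_ln f x v a : 0 < f x -> has_dd f x v a ->
  has_dd (fun y => ln (f y)) x v (a / f x).
Proof. by move=> f0 h; apply: has_dd_comp => //; exact: is_derive1_ln. Qed.
Lemma has_dd_derive f x v a : has_dd f x v a -> 'D_v f x = a.
Proof. by move=> [df <-]; rewrite deriveE. Qed.
End DD.

Lemma has_dd_coord {R : realType} n (x v : 'rV[R]_n) i :
  has_dd (fun y : 'rV[R]_n => y 0 i) x v (v 0 i).
Proof.
split; first exact: differentiable_coord.
have @f : {linear 'rV[R]_n -> R}.
  by exists (fun N : 'rV[R]_n => N 0 i); do 2![eexists]; do ?[constructor];
     rewrite ?mxE// => ? *; rewrite ?mxE//; move=> ?; rewrite !mxE.
rewrite (_ : (fun y : 'rV[R]_n => y 0 i) = f) //.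
by rewrite diff_lin //; exact: coord_continuous.
Qed.

Section Potential.
Variables (R : realType) (N : nat).
Implicit Types t : 'rV[R]_N.

Lemma cos_eq1 (x : R) : cos x = 1 -> exists n : int, x = n%:~R * (2 * pi).
Proof.
move=> cx; have pi2 : 0 < 2 * pi :> R by rewrite mulr_gt0 // pi_gt0.
pose n := Num.floor (x / (2 * pi)); pose y := x - n%:~R * (2 * pi).
have cper (m : int) (z : R) : cos (z - m%:~R * (2 * pi)) = cos z.
  have nat_per k w : cos (w + k%:R * (2 * pi)) = cos w :> R.
    elim: k w => [|k IH] w; first by rewrite mul0r addr0.
    have -> : w + k.+1%:R * (2 * pi) = (w + k%:R * (2 * pi)) + pi *+ 2.
      by rewrite -natr1 -mulr_natr; ring.
    by rewrite cosD2pi IH.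
  case: m => k; last by rewrite NegzE mulrNz mulNr opprK nat_per.
  by rewrite -[in RHS](subrK (k%:~R * (2 * pi)) z) nat_per.
have y0 : 0 <= y by rewrite subr_ge0 -ler_pdivlMr // Num.Theory.floor_le.
have y2 : y < 2 * pi.
  by rewrite ltrBlDr -{1}(mul1r (2 * pi)) -mulrDl -ltr_pdivrMr // addrC -[1]/(1%:~R)
    -intrD floorD1_gt.
have cy : cos y = 1 by rewrite cper.
exists n; apply/eqP; rewrite -subr_eq0 -/y; apply/eqP.
have pi0 := pi_gt0 R.
have [yp|yp] := leP y pi.
  by apply: cos_inj; rewrite ?cos0 // in_itv /= ?y0 ?yp ?lexx ?ltW.
(* Reflection leads back to the interval on which cos is injective. *)
suff : 2 * pi - y = 0 by lra.
apply: cos_inj; rewrite ?in_itv /=; last first.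
- by rewrite cos0 -opprB cosN -(cper 1) mul1r in cy *.
- by apply/andP; split; lra.
- by apply/andP; split; lra.
Qed.

Definition distinct_angles t := forall i j : 'I_N, i != j -> cos (t 0 i - t 0 j) != 1.

Lemma noncollision_distinct t : noncollision t -> distinct_angles t.
Proof. by move=> h i j ij; apply/eqP => /cos_eq1[n]; apply/eqP/h. Qed.

Lemma distinct_angles_near t : distinct_angles t -> \forall t' \near t,
  distinct_angles t'.
Proof.
move=> st.
have : \forall t' \near t, forall ij : 'I_N * 'I_N,
    ij.1 != ij.2 -> cos ((t' : 'rV[R]_N) 0 ij.1 - t' 0 ij.2) != 1.
  apply: (@filter_forall _ _ _ (nbhs t)) => -[i j] /=;
    case: (eqVneq i j) => [->|ij]; first exact: nearW.
  have c : (fun t' : 'rV[R]_N => cos (t' 0 i - t' 0 j) - 1) @ t -->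
    cos (t 0 i - t 0 j) - 1.
    have [d _] := has_ddB (has_dd_cos (has_ddB (has_dd_coord t 0 i)
      (has_dd_coord t 0 j))) (has_dd_cst 1 t 0).
    exact: differentiable_continuous d.
  have n0 : cos (t 0 i - t 0 j) - 1 != 0 by rewrite subr_eq0 st.
  have := @cvgr_neq0 _ _ _ _ (nbhs_filter t) _ _ c n0.
  by apply: filterS => t' h _; rewrite -subr_eq0.
by apply: filterS => t' h i j; exact: (h (i, j)).
Qed.

(** First and second derivative of the energy of a pair,
    a |-> - cos a - ln (2 - 2 cos a) / 2. *)
Definition pair_force (a : R) := sin a - 2^-1 * (sin a / (1 - cos a)).
Definition pair_stiffness (a : R) := cos a + 2^-1 / (1 - cos a).

Definition potential_gradient t l := \sum_(j < N | j != l) pair_force (t 0 l - t 0 j).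
Definition potential_hessian t : 'M[R]_N := \matrix_(i, l) \sum_(j < N | j != l)
   pair_stiffness (t 0 l - t 0 j) * ((i == l)%:R - (i == j)%:R).

Lemma sum_pairs (b : 'I_N -> 'I_N -> R) :
  \sum_(i < N) \sum_(j < N | (i < j)%N) (b i j + b j i)
  = \sum_(i < N) \sum_(j < N | j != i) b i j.
Proof.
have e : \sum_(i < N) \sum_(j < N | (i < j)%N) b j i
       = \sum_(i < N) \sum_(j < N | (j < i)%N) b i j.
  by rewrite (exchange_big_dep xpredT).
under eq_bigr do rewrite big_split /=.
rewrite big_split /= e -big_split /=; apply: eq_bigr => i _.
rewrite [RHS](bigID (fun j : 'I_N => (i < j)%N)) /=; congr (_ + _).
  by apply: eq_bigl => j; case: (ltngtP i j) => h;
    rewrite -?val_eqE /= ?andbF ?andbT //; case: ltngtP h.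
by apply: eq_bigl => j; rewrite -val_eqE /=; case: ltngtP.
Qed.

(** Since the force is odd, the pairs i < j that contain l contribute the forces
    exerted on l by all the others. *)
Lemma partial_potential t l : distinct_angles t -> partial l (@potential R N) t =
  potential_gradient t l.
Proof.
move=> st; apply: has_dd_derive.
have h i j : i != j -> has_dd (fun t : 'rV[R]_N =>
     cos (t 0 i - t 0 j) + 2^-1 * ln (2 - 2 * cos (t 0 i - t 0 j))) t (delta_mx 0 l)
     (- pair_force (t 0 i - t 0 j) * ((i == l)%:R - (j == l)%:R)).
  move=> ij; have c1 := st i j ij.
  have c0 : 0 < 2 - 2 * cos (t 0 i - t 0 j).
    by have := cos_le1 (t 0 i - t 0 j); rewrite le_eqVlt (negPf c1) /=; lra.
  have dd := has_ddB (has_dd_coord t (delta_mx 0 l) i) (has_dd_coord t (delta_mx 0 l) j).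
  apply: has_dd_eq.
    apply: has_ddD; first exact: has_dd_cos dd.
    apply: has_ddM; first exact: has_dd_cst.
    apply: has_dd_ln => //; apply: has_ddB; first exact: has_dd_cst.
    apply: has_ddM; first exact: has_dd_cst.
    exact: has_dd_cos dd.
  rewrite !mxE /= /pair_force; field.
  by rewrite -[1]mulr1 -mulNr in c0 *; apply/andP; split; apply/eqP; lra.
apply: has_dd_eq.
  apply: has_ddN; apply: has_dd_sum => i _; apply: has_dd_sum => j ij; apply: h.
  by rewrite -val_eqE /= neq_ltn ij.
have odd a : pair_force (- a) = - pair_force a.
  by rewrite /pair_force sinN cosN; ring.
pose b i j := - pair_force (t 0 i - t 0 j) * (i == l)%:R.
transitivity (- \sum_(i < N) \sum_(j < N | (i < j)%N) (b i j + b j i)).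
  congr (- _); apply: eq_bigr => i _; apply: eq_bigr => j _.
  by rewrite /b -[t 0 j - t 0 i]opprB odd; ring.
rewrite sum_pairs (bigD1 l) //= [X in _ + X]big1 => [|i il].
  by rewrite addr0 -sumrN; apply: eq_bigr => j _; rewrite /b eqxx mulr1 opprK.
by apply: big1 => j _; rewrite /b (negPf il) mulr0.
Qed.

Lemma hessian_potential t : distinct_angles t -> hessian (@potential R N) t =
  potential_hessian t.
Proof.
move=> st; apply/matrixP => i l; rewrite !mxE /partial.
rewrite (@near_eq_derive _ _ _ _ (fun t' => potential_gradient t' l)); last first.
  by apply: filterS (distinct_angles_near st) => t' st'; exact: partial_potential.
apply: has_dd_derive; apply: has_dd_sum => j jl.
have c1 : cos (t 0 l - t 0 j) != 1 by apply: st; rewrite eq_sym.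
have dd := has_ddB (has_dd_coord t (delta_mx 0 i) l) (has_dd_coord t (delta_mx 0 i) j).
have n0 : 1 - cos (t 0 l - t 0 j) != 0 by rewrite subr_eq0 eq_sym.
apply: has_dd_eq.
  apply: has_ddB; first exact: has_dd_sin dd.
  apply: has_ddM; first exact: has_dd_cst.
  apply: has_ddM; first exact: has_dd_sin dd.
  apply: has_ddV => //; apply: has_ddB; first exact: has_dd_cst.
  exact: has_dd_cos dd.
rewrite !mxE /= /pair_stiffness ![_ == i]eq_sym.
have := cos2Dsin2 (t 0 l - t 0 j).
set c := cos _ in n0 *; set s := sin _ => cs.
have s2 : s ^+ 2 = 1 - c ^+ 2 by lra.
transitivity ((c - 2^-1 * (c / (1 - c) - s ^+ 2 / (1 - c) ^+ 2)) *
   ((i == l)%:R - (i == j)%:R)); first by field.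
by rewrite s2; field.
Qed.

Lemma potential_hessian_sym t : (potential_hessian t)^T = potential_hessian t.
Proof.
have even a : pair_stiffness (- a) = pair_stiffness a by rewrite /pair_stiffness cosN.
apply/matrixP => i l; rewrite !mxE.
case: (pselect (i = l)) => [->//|/eqP il].
have e (a b : 'I_N) : a != b -> \sum_(j < N | j != b)
   pair_stiffness (t 0 b - t 0 j) * ((a == b)%:R - (a == j)%:R) =
     - pair_stiffness (t 0 b - t 0 a).
  move=> ab; rewrite (bigD1 a) //= eqxx (negPf ab) sub0r mulrN1 big1 ?addr0 // =>
    j /andP[_ ja].
  by rewrite eq_sym (negPf ja) subr0 mulr0.
by rewrite [RHS]e // [LHS]e 1?eq_sym // -[t 0 i - _]opprB even.
Qed.

Lemma potential_hessian_rotation t : (const_mx 1 : 'rV[R]_N) *m potential_hessian t = 0.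
Proof.
apply/rowP => l; rewrite !mxE; under eq_bigr do rewrite !mxE mul1r.
rewrite exchange_big /= big1 // => j jl; rewrite -mulr_sumr sumrB.
have s1 (a : 'I_N) : \sum_(i < N) (i == a)%:R = 1 :> R.
  by rewrite (bigD1 a) //= eqxx big1 ?addr0 // => i /negPf ->.
by rewrite !s1 subrr mulr0.
Qed.
End Potential.

(** * The differential of the reduced field *)

Section Planar.
Variable R : realType.
Implicit Types z w k p : R * R.
(** 1 / conj z for the complex number z. *)
Definition inv_conj z : R * R := (dot z z)^-1 *: z.
(** The square of a complex number. *)
Definition csqr p : R * R := (p.1 ^+ 2 - p.2 ^+ 2, 2 * (p.1 * p.2)).
(** - i k conj w in complex notation.  For k = 1 / conj z^2, this is the
    differential at z, in the direction w, of the vortex field i / conj z. *)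
Definition kernel_diff k w : R * R := (w.1 * k.2 - w.2 * k.1, - (w.1 * k.1 + w.2 * k.2)).

Lemma enorm_sqr z : enorm z ^+ 2 = dot z z.
Proof. by rewrite /enorm sqr_sqrtr // /dot -!expr2 addr_ge0 // sqr_ge0. Qed.

Lemma dot_eq0 z : (dot z z == 0) = (z == 0).
Proof.
rewrite /dot -!expr2 paddr_eq0 ?sqr_ge0 // !sqrf_eq0.
by case: z => a b.
Qed.

Section DD2.
Variable V : normedModType R.
Definition has_dd2 (f : V -> R * R) x v (d : R * R) :=
  has_dd (fun y => (f y).1) x v d.1 /\ has_dd (fun y => (f y).2) x v d.2.

Lemma has_dd2_eq f x v d d' : has_dd2 f x v d -> d = d' -> has_dd2 f x v d'.
Proof. by move=> h <-. Qed.
Lemma has_dd2D f g x v a b : has_dd2 f x v a -> has_dd2 g x v b ->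
  has_dd2 (fun y => f y + g y) x v (a + b).
Proof. by move=> [f1 f2] [g1 g2]; split; apply: has_ddD. Qed.
Lemma has_dd2B f g x v a b : has_dd2 f x v a -> has_dd2 g x v b ->
  has_dd2 (fun y => f y - g y) x v (a - b).
Proof. by move=> [f1 f2] [g1 g2]; split; apply: has_ddB. Qed.
Lemma has_dd2Zl f x v a (c : R) : has_dd2 f x v a ->
  has_dd2 (fun y => c *: f y) x v (c *: a).
Proof.
by move=> [f1 f2]; split;
  (apply: has_dd_eq; [apply: has_ddM; [exact: has_dd_cst|eassumption]|]);
  rewrite mulr0 addr0.
Qed.
Lemma fst_sum (I : finType) (P : pred I) (F : I -> R * R) :
  (\sum_(i | P i) F i).1 = \sum_(i | P i) (F i).1.
Proof. exact: (raddf_sum fst). Qed.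
Lemma snd_sum (I : finType) (P : pred I) (F : I -> R * R) :
  (\sum_(i | P i) F i).2 = \sum_(i | P i) (F i).2.
Proof. exact: (raddf_sum snd). Qed.
Lemma has_dd2_sum (I : finType) (P : pred I) (f : I -> V -> R * R) x v a :
  (forall i, P i -> has_dd2 (f i) x v (a i)) ->
  has_dd2 (fun y => \sum_(i | P i) f i y) x v (\sum_(i | P i) a i).
Proof.
move=> h; split; rewrite ?fst_sum ?snd_sum.
  under eq_fun do rewrite fst_sum; by apply: has_dd_sum => i /h[].
under eq_fun do rewrite snd_sum; by apply: has_dd_sum => i /h[].
Qed.
Lemma has_dd2_perp f x v a : has_dd2 f x v a ->
  has_dd2 (fun y => perp (f y)) x v (perp a).
Proof. by move=> [f1 f2]; split=> //; apply: has_ddN. Qed.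
Lemma has_dd_dot f g x v a b : has_dd2 f x v a -> has_dd2 g x v b ->
  has_dd (fun y => dot (f y) (g y)) x v (dot (f x) b + dot (g x) a).
Proof.
move=> [f1 f2] [g1 g2]; apply: has_dd_eq; first by apply: has_ddD; apply: has_ddM;
  eassumption.
by rewrite /dot /= /GRing.scale /=; ring.
Qed.
Lemma has_dd2_vortex f x v a (c : R) : f x != 0 -> has_dd2 f x v a ->
  has_dd2 (fun y => (c / enorm (f y) ^+ 2) *: perp (f y)) x v
    (c *: kernel_diff (csqr (inv_conj (f x))) a).
Proof.
rewrite -dot_eq0 => f0 h.
have d1 : has_dd (fun y => c / enorm (f y) ^+ 2) x v
  (- c * (dot (f x) (f x)) ^- 2 * (2 * dot (f x) a)).
  under eq_fun do rewrite enorm_sqr.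
  apply: has_dd_eq.
    by apply: has_ddM; [exact: has_dd_cst|apply: has_ddV => //; exact: (has_dd_dot h h)].
  by rewrite /= /GRing.scale /=; ring.
have [h1 h2] := h; split; (apply: has_dd_eq; [apply: has_ddM; [exact: d1|]|]).
- exact: has_ddN h2.
- rewrite /= enorm_sqr /kernel_diff /csqr /inv_conj /=; move: f0; rewrite /dot.
  by rewrite /GRing.scale /=; case: (f x) => p q /= f0; field.
- exact: h1.
rewrite /= enorm_sqr /kernel_diff /csqr /inv_conj /=; move: f0; rewrite /dot.
by rewrite /GRing.scale /=; case: (f x) => p q /= f0; field.
Qed.
End DD2.
End Planar.

Lemma differentiable_rV (R : realType) (V : normedModType R) n (f : V -> 'rV[R]_n) x :
  (forall j, differentiable (fun y => f y 0 j) x) -> differentiable f x.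
Proof.
move=> h; have -> : f = \sum_(j < n) (fun y => f y 0 j *: delta_mx 0 j).
  apply/funext => y; rewrite fct_sumE [LHS]row_sum_delta; exact: eq_bigr.
by apply: differentiable_sum => j; apply: differentiableZl.
Qed.

Section Field.
Variables (R : realType) (N : nat) (eps : R).
Implicit Types (r t : 'rV[R]_N).

Definition small_pos r t (j : 'I_N) : R * R := r 0 j *: radial_dir (t 0 j).
Definition core_pos r t : R * R := central_position eps (small_pos r t).

Lemma polar_config0 r t : polar_config eps r t ord0 = core_pos r t.
Proof. by rewrite /polar_config unlift_none. Qed.
Lemma polar_configS r t j : polar_config eps r t (lift ord0 j) = small_pos r t j.
Proof. by rewrite /polar_config liftK. Qed.

Lemma rotating_velocityE r t j : rotating_velocity eps r t j =
  (1 / enorm (small_pos r t j - core_pos r t) ^+ 2) *: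
    perp (small_pos r t j - core_pos r t)
  + \sum_(i < N | i != j) (eps / enorm (small_pos r t j - small_pos r t i) ^+ 2) *:
       perp (small_pos r t j - small_pos r t i)
  - perp (small_pos r t j).
Proof.
rewrite /rotating_velocity /velocity big_mkcond big_ord_recl /=
  polar_configS polar_config0.
congr (_ + _ - _); rewrite [RHS]big_mkcond; apply: eq_bigr => i _.
by rewrite (inj_eq (@lift_inj _ ord0)) polar_configS.
Qed.

(** The variation of the position of the j-th vortex induced by the variation
    [v] of the polar coordinates. *)
Definition planar r t (v : 'rV[R]_(N + N)) (j : 'I_N) : R * R :=
  lsubmx v 0 j *: radial_dir (t 0 j) + (r 0 j * rsubmx v 0 j) *: angular_dir (t 0 j).

(** The differential of the rotating velocity, including the displacement of
    the central vortex, which follows the others. *)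
Definition field_diff r t v j : R * R :=
  kernel_diff (csqr (inv_conj (small_pos r t j - core_pos r t)))
     (planar r t v j + eps *: \sum_i planar r t v i)
  + eps *: (\sum_(i < N | i != j) kernel_diff
    (csqr (inv_conj (small_pos r t j - small_pos r t i)))
       (planar r t v j - planar r t v i))
  - perp (planar r t v j).

Section At.
Variables r t : 'rV[R]_N.
Hypothesis eq : polar_rel_equilibrium eps r t.
Let x := row_mx r t.

Let lx : lsubmx x = r. Proof. exact: row_mxKl. Qed.
Let rx : rsubmx x = t. Proof. exact: row_mxKr. Qed.

Lemma equilibrium_radius_neq0 j : r 0 j != 0.
Proof. by rewrite gt_eqF //; exact: eq.1. Qed.
Let r0 := equilibrium_radius_neq0.

Lemma equilibrium_velocity0 j : rotating_velocity eps r t j = 0.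
Proof. by have [_ [_ _ h]] := eq; rewrite /rotating_velocity -h subrr. Qed.

Lemma equilibrium_sep i j : i != j -> small_pos r t i - small_pos r t j != 0.
Proof.
have [_ [inj _ _]] := eq; move=> ij; rewrite subr_eq0 -!polar_configS.
by rewrite (inj_eq inj) (inj_eq (@lift_inj _ ord0)).
Qed.
Lemma equilibrium_sep0 j : small_pos r t j - core_pos r t != 0.
Proof.
have [_ [inj _ _]] := eq; rewrite subr_eq0 -polar_configS -polar_config0.
by rewrite (inj_eq inj) eq_sym neq_lift.
Qed.

Lemma has_dd2_small_pos v j :
  has_dd2 (fun y : 'rV[R]_(N + N) => small_pos (lsubmx y) (rsubmx y) j) x v
    (planar r t v j).
Proof.
have hl : has_dd (fun y : 'rV[R]_(N + N) => lsubmx y 0 j) x v (lsubmx v 0 j).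
  under eq_fun do rewrite mxE; rewrite mxE; exact: has_dd_coord.
have hr : has_dd (fun y : 'rV[R]_(N + N) => rsubmx y 0 j) x v (rsubmx v 0 j).
  under eq_fun do rewrite mxE; rewrite mxE; exact: has_dd_coord.
split; (apply: has_dd_eq; [apply: has_ddM; [exact: hl|]|]).
- exact: has_dd_cos hr.
- by rewrite /= lx rx /planar /= /GRing.scale /=; ring.
- exact: has_dd_sin hr.
- by rewrite /= lx rx /planar /= /GRing.scale /=; ring.
Qed.

Lemma has_dd2_angular v j :
  has_dd2 (fun y : 'rV[R]_(N + N) => angular_dir (rsubmx y 0 j)) x v
    (- rsubmx v 0 j *: radial_dir (t 0 j)).
Proof.
have hr : has_dd (fun y : 'rV[R]_(N + N) => rsubmx y 0 j) x v (rsubmx v 0 j).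
  under eq_fun do rewrite mxE; rewrite mxE; exact: has_dd_coord.
split; apply: has_dd_eq.
- exact: has_ddN (has_dd_sin hr).
- by rewrite /= rx /= /GRing.scale /=; ring.
- exact: has_dd_cos hr.
- by rewrite /= rx /= /GRing.scale /=; ring.
Qed.

Lemma has_dd2_radial v j :
  has_dd2 (fun y : 'rV[R]_(N + N) => radial_dir (rsubmx y 0 j)) x v
    (rsubmx v 0 j *: angular_dir (t 0 j)).
Proof.
have hr : has_dd (fun y : 'rV[R]_(N + N) => rsubmx y 0 j) x v (rsubmx v 0 j).
  under eq_fun do rewrite mxE; rewrite mxE; exact: has_dd_coord.
split; apply: has_dd_eq.
- exact: has_dd_cos hr.
- by rewrite /= rx /= /GRing.scale /=; ring.
- exact: has_dd_sin hr.
- by rewrite /= rx /= /GRing.scale /=; ring.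
Qed.

Lemma has_dd2_rotating_velocity v j :
  has_dd2 (fun y : 'rV[R]_(N + N) => rotating_velocity eps (lsubmx y) (rsubmx y) j) x v
    (field_diff r t v j).
Proof.
under eq_fun do rewrite rotating_velocityE.
have hs := has_dd2_small_pos v.
apply: has_dd2B; last exact: has_dd2_perp.
apply: has_dd2D.
  rewrite -[kernel_diff _ _]scale1r.
  have hc : has_dd2 (fun y : 'rV[R]_(N + N) => small_pos (lsubmx y) (rsubmx y) j -
      core_pos (lsubmx y) (rsubmx y)) x v (planar r t v j + eps *: \sum_i planar r t v i).
    apply: has_dd2_eq.
      apply: has_dd2B; first exact: hs.
      by apply: has_dd2Zl; apply: has_dd2_sum => i _; exact: hs.
    by rewrite scaleNr opprK.
  have := @has_dd2_vortex _ _ _ x v _ 1 _ hc; rewrite lx rx; apply.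
  exact: equilibrium_sep0.
rewrite scaler_sumr; apply: has_dd2_sum => i ij.
have hc := has_dd2B (hs j) (hs i).
have := @has_dd2_vortex _ _ _ x v _ eps _ hc; rewrite lx rx; apply.
by apply: equilibrium_sep; rewrite eq_sym.
Qed.

Let ddl v j : has_dd (fun y => reduced_field eps y 0 (lshift N j)) x v
   (dot (field_diff r t v j) (radial_dir (t 0 j))).
Proof.
rewrite /reduced_field; under eq_fun do rewrite row_mxEl mxE.
apply: has_dd_eq.
  exact: has_dd_dot (has_dd2_rotating_velocity v j) (has_dd2_radial v j).
rewrite /= lx rx equilibrium_velocity0 /dot /= /GRing.scale /=; ring.
Qed.

Let ddr v j : has_dd (fun y => reduced_field eps y 0 (rshift N j)) x v
   (dot (field_diff r t v j) (angular_dir (t 0 j)) / r 0 j).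
Proof.
rewrite /reduced_field; under eq_fun do rewrite row_mxEr mxE.
apply: has_dd_eq.
  apply: has_ddM.
    exact: has_dd_dot (has_dd2_rotating_velocity v j) (has_dd2_angular v j).
  apply: has_ddV; first by rewrite lx.
  under eq_fun do rewrite mxE; exact: has_dd_coord.
rewrite /= lx rx equilibrium_velocity0 /dot /= /GRing.scale /=; ring.
Qed.

(** The frame in which the velocity is decomposed turns with the vortex and the
    angular component is divided by the radius, but the derivatives of these
    factors multiply the rotating velocity, which is zero at an equilibrium. *)
Lemma mul_linearization v : v *m linearization eps r t =
  row_mx (\row_j dot (field_diff r t v j) (radial_dir (t 0 j)))
         (\row_j (dot (field_diff r t v j) (angular_dir (t 0 j)) / r 0 j)).
Proof.
have df : differentiable (@reduced_field R N eps) x.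
  apply: differentiable_rV => j; case: (split_ordP j) => i ->.
    by have [] := ddl 0 i.
  by have [] := ddr 0 i.
rewrite /linearization -(deriveEjacobian v df) derive_mx; last exact: diff_derivable.
apply/rowP => j; rewrite mxE; case: (split_ordP j) => i ->.
  by rewrite row_mxEl mxE (has_dd_derive (ddl v i)).
by rewrite row_mxEr mxE (has_dd_derive (ddr v i)).
Qed.

End At.
End Field.

(** * Symmetries and Hamiltonian structure *)

Definition cross {R : realType} (u w : R * R) := dot (perp u) w.
(** Scaling in [R * R] unfolds to the action of [R] on itself, which the ring
    tactic only recognizes as a product once it is unfolded too. *)
Ltac planar_simp := rewrite /cross /kernel_diff /csqr /inv_conj /perp /dot /=
  /GRing.scale /=.

Section PlanarAlgebra.
Variable R : realType.
Implicit Types z w k p u : R * R.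

Lemma pairP u w : u.1 = w.1 -> u.2 = w.2 -> u = w.
Proof. by case: u w => [a b] [c d] /= -> ->. Qed.


Lemma kernel_diffD k u w : kernel_diff k (u + w) = kernel_diff k u + kernel_diff k w.
Proof. by apply: pairP; planar_simp; ring. Qed.
Lemma kernel_diffZ k (c : R) w : kernel_diff k (c *: w) = c *: kernel_diff k w.
Proof. by apply: pairP; planar_simp; ring. Qed.
Lemma kernel_diffB k u w : kernel_diff k (u - w) = kernel_diff k u - kernel_diff k w.
Proof. by apply: pairP; planar_simp; ring. Qed.

Lemma perpD u w : perp (u + w) = perp u + perp w.
Proof. by apply: pairP; planar_simp; ring. Qed.
Lemma perpZ (c : R) w : perp (c *: w) = c *: perp w.
Proof. by apply: pairP; planar_simp; ring. Qed.
Lemma perp_sum (I : finType) (P : pred I) (F : I -> R * R) :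
  perp (\sum_(i | P i) F i) = \sum_(i | P i) perp (F i).
Proof.
by apply: pairP; rewrite ?fst_sum ?snd_sum /perp /= ?fst_sum ?snd_sum ?sumrN.
Qed.

Lemma perp_vortex z : (1 / enorm z ^+ 2) *: perp z = perp (inv_conj z).
Proof. by rewrite enorm_sqr mul1r -perpZ. Qed.

Lemma kernel_diff_self z : z != 0 ->
  kernel_diff (csqr (inv_conj z)) z = - perp (inv_conj z).
Proof.
rewrite -dot_eq0 => z0; apply: pairP;
move: z0; planar_simp;
by case: z => a b /= z0; field.
Qed.
Lemma kernel_diff_perp z : z != 0 ->
  kernel_diff (csqr (inv_conj z)) (perp z) = - inv_conj z.
Proof.
rewrite -dot_eq0 => z0; apply: pairP;
move: z0; planar_simp;
by case: z => a b /= z0; field.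
Qed.

Lemma csqr_inv_conjN z : csqr (inv_conj (- z)) = csqr (inv_conj z).
Proof.
apply: pairP; planar_simp; case: z => a b /=;
by rewrite !mulrNN; ring.
Qed.

Lemma crossDl u w z : cross (u + w) z = cross u z + cross w z.
Proof. by planar_simp; ring. Qed.
Lemma crossDr u w z : cross z (u + w) = cross z u + cross z w.
Proof. by planar_simp; ring. Qed.
Lemma crossZl (c : R) u w : cross (c *: u) w = c * cross u w.
Proof. by planar_simp; ring. Qed.
Lemma crossZr (c : R) u w : cross w (c *: u) = c * cross w u.
Proof. by planar_simp; ring. Qed.
Lemma crossC u w : cross u w = - cross w u.
Proof. by planar_simp; ring. Qed.
Lemma cross_suml (I : finType) (P : pred I) (F : I -> R * R) z :
  cross (\sum_(i | P i) F i) z = \sum_(i | P i) cross (F i) z.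
Proof.
rewrite /cross /dot /= fst_sum snd_sum -sumrN !mulr_suml -big_split.
exact: eq_bigr.
Qed.
Lemma cross_sumr (I : finType) (P : pred I) (F : I -> R * R) z :
  cross z (\sum_(i | P i) F i) = \sum_(i | P i) cross z (F i).
Proof. by rewrite crossC cross_suml -sumrN; apply: eq_bigr => i _; rewrite -crossC. Qed.
Lemma cross_perp u w : cross (- perp u) w = dot u w.
Proof. by planar_simp; ring. Qed.

Lemma cross_kernel_diff k u w : cross (kernel_diff k u) w = cross (kernel_diff k w) u.
Proof. by planar_simp; ring. Qed.

Lemma radial_angular u (a : R) :
  dot u (radial_dir a) *: radial_dir a + dot u (angular_dir a) *: angular_dir a = u.
Proof.
have e := cos2Dsin2 a.
apply: pairP; rewrite /dot /= ?fstZ ?sndZ /=.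
  transitivity (u.1 * (cos a ^+ 2 + sin a ^+ 2));
    [rewrite /= /GRing.scale /=; ring|by rewrite e mulr1].
transitivity (u.2 * (cos a ^+ 2 + sin a ^+ 2));
  [rewrite /= /GRing.scale /=; ring|by rewrite e mulr1].
Qed.
Lemma dot_radial_radial (a : R) : dot (radial_dir a) (radial_dir a) = 1.
Proof. by rewrite /dot /= -!expr2 cos2Dsin2. Qed.
Lemma dot_angular_angular (a : R) : dot (angular_dir a) (angular_dir a) = 1.
Proof. by rewrite /dot /= mulrNN -!expr2 addrC cos2Dsin2. Qed.
Lemma dot_angular_radial (a : R) : dot (angular_dir a) (radial_dir a) = 0.
Proof. by planar_simp; ring. Qed.
Lemma perp_radial (a : R) : perp (radial_dir a) = angular_dir a.
Proof. by []. Qed.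
Lemma perp_angular (a : R) : perp (angular_dir a) = - radial_dir a.
Proof. by []. Qed.
Lemma dotZl (c : R) u w : dot (c *: u) w = c * dot u w.
Proof. by planar_simp; ring. Qed.
Lemma dotDl u w z : dot (u + w) z = dot u z + dot w z.
Proof. by planar_simp; ring. Qed.
Lemma dotNl u z : dot (- u) z = - dot u z.
Proof. by planar_simp; ring. Qed.
End PlanarAlgebra.

Section Equilibrium.
Variables (R : realType) (N : nat) (eps : R).
Variables r t : 'rV[R]_N.
Hypothesis eq : polar_rel_equilibrium eps r t.

Definition interaction (r t : 'rV[R]_N) j : R * R :=
  \sum_(i < N | i != j) inv_conj (small_pos r t j - small_pos r t i).
Let q := small_pos r t.
Let q0 := core_pos eps r t.
Let L := linearization eps r t.

(** The equilibrium condition with the common rotation by a right angle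
    removed. *)
Lemma equilibrium_eq j : q j = inv_conj (q j - q0) + eps *: interaction r t j.
Proof.
have := equilibrium_velocity0 eq j; rewrite rotating_velocityE perp_vortex -/q -/q0.
have -> : \sum_(i < N | i != j) (eps / enorm (q j - q i) ^+ 2) *: perp (q j - q i)
   = perp (eps *: interaction r t j).
  rewrite perpZ /interaction perp_sum scaler_sumr; apply: eq_bigr => i _.
  by rewrite -perp_vortex scalerA mulrA mulr1.
rewrite -perpD => /eqP; rewrite subr_eq0 /perp => /eqP [/oppr_inj h2 h1].
by apply: pairP; rewrite ?h1 ?h2.
Qed.

Let q_center j : q j - q0 = q j + eps *: \sum_i q i.
Proof. by rewrite /q0 /core_pos /central_position scaleNr opprK. Qed.

(** Rotating an equilibrium gives an equilibrium.  In formulas, the differential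
    of i / conj z maps i z to - 1 / conj z, and the sum of these terms is
    recognized in the equilibrium equation. *)
Lemma rotation_kernel : rotation_vector R N *m L = 0.
Proof.
rewrite (mul_linearization eq).
have pl j : planar r t (rotation_vector R N) j = perp (q j).
  by rewrite /planar row_mxKl row_mxKr !mxE scale0r add0r mulr1 /q /small_pos perpZ.
suff h j : field_diff eps r t (rotation_vector R N) j = 0.
  apply/rowP => j; rewrite [RHS]mxE; case: (split_ordP j) => i ->.
    by rewrite row_mxEl mxE h /dot /= !mul0r addr0.
  by rewrite row_mxEr mxE h /dot /= !mul0r addr0 mul0r.
rewrite /field_diff pl.
have -> : perp (q j) + eps *: \sum_i planar r t (rotation_vector R N) i = perp (q j - q0).
  rewrite q_center perpD perpZ perp_sum; congr (_ + _ *: _).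
  by apply: eq_bigr => i _; rewrite pl.
rewrite -/q -/q0 kernel_diff_perp ?(equilibrium_sep0 eq) //.
have -> : \sum_(i < N | i != j) kernel_diff (csqr (inv_conj (q j - q i)))
   (perp (q j) - planar r t (rotation_vector R N) i) = - interaction r t j.
  rewrite -sumrN; apply: eq_bigr => i ij; rewrite pl.
  have -> : perp (q j) - perp (q i) = perp (q j - q i) by apply: pairP; planar_simp; ring.
  by rewrite kernel_diff_perp // (equilibrium_sep eq) // eq_sym.
have -> : - perp (perp (q j)) = q j by apply: pairP; planar_simp; ring.
by rewrite [X in _ + X]equilibrium_eq scalerN; apply: pairP; planar_simp; ring.
Qed.

(** The vortex field is homogeneous of degree - 1 and the rotation of degree 1,
    so to first order the configuration dilated by 1 + h turns at a rate
    multiplied by 1 - 2 h. *)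
Lemma dilation_eq : row_mx r 0 *m L = - 2 *: rotation_vector R N.
Proof.
rewrite (mul_linearization eq).
have pl j : planar r t (row_mx r 0) j = q j.
  by rewrite /planar row_mxKl row_mxKr !mxE mulr0 scale0r addr0.
suff h j : field_diff eps r t (row_mx r 0) j = - 2 *: perp (q j).
  apply/rowP => j; rewrite [RHS]mxE; case: (split_ordP j) => i ->.
    by rewrite !row_mxEl !mxE h mulr0 -perpZ /q /small_pos !(perpZ, dotZl)
      perp_radial dot_angular_radial !mulr0.
  rewrite !row_mxEr !mxE h /q /small_pos !(perpZ, dotZl) perp_radial dot_angular_angular.
  by field; exact: equilibrium_radius_neq0 eq i.
rewrite /field_diff pl.
have -> : q j + eps *: \sum_i planar r t (row_mx r 0) i = q j - q0.
  by rewrite q_center; congr (_ + _ *: _); apply: eq_bigr => i _; rewrite pl.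
rewrite -/q -/q0 kernel_diff_self ?(equilibrium_sep0 eq) //.
have -> : \sum_(i < N | i != j) kernel_diff (csqr (inv_conj (q j - q i)))
   (q j - planar r t (row_mx r 0) i) = - perp (interaction r t j).
  rewrite /interaction perp_sum -sumrN; apply: eq_bigr => i ij; rewrite pl.
  by rewrite kernel_diff_self // (equilibrium_sep eq) // eq_sym.
have /(congr1 (@perp R)) := equilibrium_eq j; rewrite perpD perpZ => e.
rewrite scalerN -opprD -e.
by apply: pairP; planar_simp; ring.
Qed.

Definition symplectic_entry (u w : R * R) (j l : 'I_N) := ((j == l)%:R + eps) * cross u w.
(** The form sum_j dx_j dy_j + eps (sum_j dx_j) (sum_j dy_j), in polar
    coordinates.  Up to the factor eps it is the restriction of the form
    sum_i Gamma_i dx_i dy_i of the full problem to the configurations with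
    center of vorticity at the origin. *)
Definition symplectic_mx : 'M[R]_(N + N) := block_mx
  (\matrix_(j, l) symplectic_entry (radial_dir (t 0 j)) (radial_dir (t 0 l)) j l)
  (\matrix_(j, l) symplectic_entry (radial_dir (t 0 j))
    (r 0 l *: angular_dir (t 0 l)) j l)
  (\matrix_(j, l) symplectic_entry (r 0 j *: angular_dir (t 0 j))
    (radial_dir (t 0 l)) j l)
  (\matrix_(j, l) symplectic_entry (r 0 j *: angular_dir (t 0 j))
    (r 0 l *: angular_dir (t 0 l)) j l).

Lemma symplectic_mx_antisym : symplectic_mx^T = - symplectic_mx.
Proof.
rewrite tr_block_mx opp_block_mx; congr block_mx; apply/matrixP => i j; rewrite !mxE;
  by rewrite /symplectic_entry crossC mulrN eq_sym.
Qed.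

Definition symplectic_form (U W : 'I_N -> R * R) :=
  \sum_j cross (U j) (W j) + eps * cross (\sum_j U j) (\sum_j W j).

Lemma symplectic_mxE u v :
  (u *m symplectic_mx *m v^T) 0 0 = symplectic_form (planar r t u) (planar r t v).
Proof.
have -> : symplectic_form (planar r t u) (planar r t v) =
    \sum_j \sum_l symplectic_entry (planar r t u j) (planar r t v l) j l.
  rewrite /symplectic_form cross_suml mulr_sumr -big_split; apply: eq_bigr => j _ /=.
  rewrite cross_sumr mulr_sumr (bigD1 j) //= [RHS](bigD1 j) //= addrA; congr (_ + _).
    by rewrite /symplectic_entry eqxx /=; ring.
  by apply: eq_bigr => l lj; rewrite /symplectic_entry eq_sym (negPf lj) add0r.
have qE (M : 'M[R]_N) (a b : 'rV[R]_N) :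
    (a *m M *m b^T) 0 0 = \sum_j \sum_l a 0 j * M j l * b 0 l.
  rewrite -/(qform M a b) qformE exchange_big /=; apply: eq_bigr => j _.
  by rewrite mulr_suml.
rewrite -{1}[u]hsubmxK -{1}[v]hsubmxK tr_row_mx mul_row_block mul_row_col.
rewrite !mulmxDl mxE [X in X + _]mxE [X in _ + X]mxE !qE -!big_split.
apply: eq_bigr => j _; rewrite -!big_split; apply: eq_bigr => l _ /=; rewrite !mxE.
rewrite /symplectic_entry /planar !(crossDl, crossDr, crossZl, crossZr) !mxE; ring.
Qed.

Lemma planar_linearization u j :
  planar r t (u *m L) j = field_diff eps r t u j.
Proof.
rewrite (mul_linearization eq) /planar row_mxKl row_mxKr !mxE mulrC divfK.
  exact: radial_angular.
exact: equilibrium_radius_neq0 eq j.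
Qed.

(** L composed with the symplectic form is the Hessian of the augmented energy.
    Its symmetry is visible on the formula: the interaction with the core
    depends on the displacements relative to the core, and the mutual
    interactions, once the terms (j, i) and (i, j) are grouped, on the relative
    displacements. *)
Lemma linearization_hamiltonian : (L *m symplectic_mx)^T = L *m symplectic_mx.
Proof.
suff h (u v : 'rV[R]_(N + N)) : (u *m (L *m symplectic_mx) *m v^T) 0 0 =
  (v *m (L *m symplectic_mx) *m u^T) 0 0.
  apply/matrixP => i j; rewrite mxE.
  have := h (delta_mx 0 j) (delta_mx 0 i).
  by rewrite !trmx_delta -!rowE -!colE !mxE.
rewrite !mulmxA !symplectic_mxE.
pose k0 j := csqr (inv_conj (q j - q0)); pose k j i := csqr (inv_conj (q j - q i)).
(* The value of the form, written so that U and W visibly play the same role. *)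
pose form (U W : 'I_N -> R * R) := 
  \sum_j cross (kernel_diff (k0 j) (U j + eps *: \sum_i U i)) (W j + eps *: \sum_i W i)
  + eps * (\sum_(j < N) \sum_(i < N | (j < i)%N) cross
    (kernel_diff (k j i) (U j - U i)) (W j - W i))
  + \sum_j dot (U j) (W j) + eps * dot (\sum_j U j) (\sum_j W j).
have kC i j : k i j = k j i by rewrite /k -opprB csqr_inv_conjN.
have formE u' v' : symplectic_form (planar r t (u' *m L)) (planar r t v') =
    form (planar r t u') (planar r t v').
  set U' := planar r t u'; set W' := planar r t v'.
  rewrite /symplectic_form.
  under eq_bigr do rewrite planar_linearization.
  have -> : \sum_j planar r t (u' *m L) j =
    \sum_j (kernel_diff (k0 j) (U' j + eps *: \sum_i U' i)
       - perp (U' j)) + eps *: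
         \sum_(j < N) \sum_(i < N | i != j) kernel_diff (k j i) (U' j - U' i).
    rewrite [X in _ = _ + X]scaler_sumr -big_split; apply: eq_bigr => j _.
    by rewrite planar_linearization /field_diff /= addrAC.
  set S := \sum_j W' j.
  have anti : cross (\sum_(j < N) \sum_(i < N | i != j) kernel_diff (k j i)
    (U' j - U' i)) S = 0.
    rewrite cross_suml; under eq_bigr do rewrite cross_suml.
    rewrite -(sum_pairs (fun j i => cross (kernel_diff (k j i) (U' j - U' i)) S)).
    rewrite big1 // => j _; rewrite big1 // => i _;
      rewrite -crossDl (kC j i) -kernel_diffD.
    by rewrite addrA subrK subrr; planar_simp; ring.
  rewrite crossDl crossZl anti mulr0 addr0 cross_suml.
  have -> : \sum_j cross (field_diff eps r t u' j) (W' j) =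
     \sum_j (cross (kernel_diff (k0 j) (U' j + eps *: \sum_i U' i)) (W' j)
       + dot (U' j) (W' j))
     + eps * \sum_(j < N) \sum_(i < N | i != j) cross
       (kernel_diff (k j i) (U' j - U' i)) (W' j).
    rewrite mulr_sumr -big_split; apply: eq_bigr => j _ /=.
    by rewrite /field_diff !crossDl crossZl cross_suml cross_perp addrAC.
  rewrite -(sum_pairs (fun j i => cross (kernel_diff (k j i) (U' j - U' i)) (W' j))).
  have -> : \sum_(i < N) \sum_(j < N | (i < j)%N)
     (cross (kernel_diff (k i j) (U' i - U' j)) (W' i) +
      cross (kernel_diff (k j i) (U' j - U' i)) (W' j)) =
     \sum_(i < N) \sum_(j < N | (i < j)%N)
      cross (kernel_diff (k i j) (U' i - U' j)) (W' i - W' j).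
    apply: eq_bigr => i _; apply: eq_bigr => j _.
    by rewrite (kC j i) /cross /dot /perp /kernel_diff /=; ring.
  rewrite /form -/S.
  have -> : dot (\sum_j U' j) S = \sum_j dot (U' j) S.
    by rewrite /dot fst_sum snd_sum !mulr_suml -big_split.
  rewrite addrAC -[RHS]addrA [RHS]addrAC; congr (_ + _).
  rewrite !mulr_sumr -!big_split; apply: eq_bigr => j _ /=.
  by rewrite crossDr crossZr crossDl cross_perp; ring.
rewrite !formE /form; congr (_ + _ * _ + _ + _ * _).
- by apply: eq_bigr => j _; exact: cross_kernel_diff.
- by apply: eq_bigr => j _; apply: eq_bigr => i _; exact: cross_kernel_diff.
- by apply: eq_bigr => j _; planar_simp; ring.
by planar_simp; ring.
Qed.
End Equilibrium.

(** * The blocks of the linearization *)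

Section Blocks.
Variables (R : realType) (N : nat).
Section Def.
Variables (eps : R) (r t : 'rV[R]_N).
Let q := small_pos r t.
Let g := interaction r t.
Let er j := radial_dir (t 0 j).
Let et j := angular_dir (t 0 j).

(** At an equilibrium this is 1 / conj (q_j - q_0), in a form that depends
    polynomially on [eps]. *)
Definition regular_pos j := q j - eps *: g j.
Definition pair_kernel j i := csqr (inv_conj (q j - q i)).
(** The terms of the differential that carry the factor [eps], for the
    displacement [W] of the vortex [l] alone: mutual interactions, and motion of
    the core that balances the displacement. *)
Definition coupling l W j : R * R := (l == j)%:R *:
  (\sum_(i < N | i != j) kernel_diff (pair_kernel j i) W)
  + kernel_diff (csqr (regular_pos j)) W - kernel_diff (pair_kernel j l) W.
(** The blocks of the linearization, without the factor [eps] in front of three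
    of them.  They make sense and are continuous at [eps = 0].  The letters r
    and t stand for radius and angle; the first one refers to the variation, the
    second one to the component of the field. *)
Definition blk_rr : 'M[R]_N := \matrix_(l, j)
  ((l == j)%:R * (- 2 * dot (g j) (et j) * (r 0 j - eps * dot (g j) (er j)))
   + dot (coupling l (er l) j) (er j)).
Definition blk_rt : 'M[R]_N := \matrix_(l, j)
  (((l == j)%:R * dot (kernel_diff (csqr (regular_pos j)) (er j) - et j) (et j)
   + eps * dot (coupling l (er l) j) (et j)) / r 0 j).
Definition blk_tr : 'M[R]_N := \matrix_(l, j)
  ((l == j)%:R * (r 0 j * (r 0 j * dot (er j) (\sum_i q i) - eps * dot (g j) (\sum_i q i)
      + r 0 j * dot (g j) (er j) - eps * (dot (g j) (er j) ^+ 2 - dot (g j) (et j) ^+ 2)))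
   + dot (coupling l (r 0 l *: et l) j) (er j)).
Definition blk_tt : 'M[R]_N := \matrix_(l, j)
  (((l == j)%:R * (r 0 j * (2 * dot (g j) (et j) * (r 0 j - eps * dot (g j) (er j))))
   + dot (coupling l (r 0 l *: et l) j) (et j)) / r 0 j).
End Def.

Lemma pair_kernelxx (r t : 'rV[R]_N) j : pair_kernel r t j j = 0.
Proof. by rewrite /pair_kernel subrr; apply: pairP; planar_simp; ring. Qed.

Lemma kernel_diff0 (W : R * R) : kernel_diff 0 W = 0.
Proof. by apply: pairP; planar_simp; ring. Qed.

Lemma dot_kernel_rr (p : R * R) a :
  dot (kernel_diff (csqr p) (radial_dir a)) (radial_dir a)
  = 2 * (dot p (radial_dir a) * dot p (angular_dir a)).
Proof. by planar_simp; ring. Qed.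
Lemma dot_kernel_tt (p : R * R) a :
  dot (kernel_diff (csqr p) (angular_dir a)) (angular_dir a)
  = - 2 * (dot p (radial_dir a) * dot p (angular_dir a)).
Proof. by planar_simp; ring. Qed.
Lemma dot_kernel_tr (p : R * R) a :
  dot (kernel_diff (csqr p) (angular_dir a)) (radial_dir a)
  = dot p (angular_dir a) ^+ 2 - dot p (radial_dir a) ^+ 2.
Proof. by planar_simp; ring. Qed.

Section At.
Variables (eps : R) (r t : 'rV[R]_N).
Hypothesis eq : polar_rel_equilibrium eps r t.
Let q := small_pos r t.
Let g := interaction r t.
Let er j := radial_dir (t 0 j).
Let et j := angular_dir (t 0 j).
Let r0 j : r 0 j != 0. Proof. exact: equilibrium_radius_neq0 eq j. Qed.

Let regE j : inv_conj (small_pos r t j - core_pos eps r t) = regular_pos eps r t j.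
Proof. by apply/eqP; rewrite eq_sym subr_eq; apply/eqP; exact: equilibrium_eq. Qed.

Lemma field_diff_delta v l W j : (forall j, planar r t v j = (l == j)%:R *: W) ->
  field_diff eps r t v j = (l == j)%:R *:
    (kernel_diff (csqr (regular_pos eps r t j)) W - perp W)
    + eps *: coupling eps r t l W j.
Proof.
move=> pl; rewrite /field_diff regE.
have -> : \sum_i planar r t v i = W.
  rewrite (bigD1 l) //= pl eqxx scale1r big1 ?addr0 // => i il.
  by rewrite pl eq_sym (negPf il) scale0r.
have -> : \sum_(i < N | i != j) kernel_diff
  (csqr (inv_conj (small_pos r t j - small_pos r t i)))
   (planar r t v j - planar r t v i) =
   (l == j)%:R *: (\sum_(i < N | i != j) kernel_diff (pair_kernel r t j i) W)
    - kernel_diff (pair_kernel r t j l) W.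
  under eq_bigr do rewrite -/(pair_kernel r t j _) !pl kernel_diffB !kernel_diffZ.
  rewrite sumrB scaler_sumr; congr (_ - _).
  have [->|lj] := pselect (l = j).
    rewrite pair_kernelxx kernel_diff0 big1 // => i ij.
    by rewrite eq_sym (negPf ij) scale0r.
  rewrite (bigD1 l) /=; last exact/eqP.
  rewrite eqxx scale1r big1 ?addr0 // => i /andP[_ il].
  by rewrite eq_sym (negPf il) scale0r.
rewrite pl kernel_diffD !kernel_diffZ perpZ /coupling.
by apply: pairP; planar_simp; ring.
Qed.

Let planar_r l j : planar r t (delta_mx 0 (lshift N l)) j = (l == j)%:R *: er l.
Proof.
rewrite /planar !mxE !eqxx /=
  [rshift N j == _]eq_sym eq_lrshift (inj_eq (@lshift_inj _ _)) mulr0 scale0r addr0.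
by rewrite eq_sym; case: (l =P j) => [->|] //; rewrite !scale0r.
Qed.
Let planar_t l j : planar r t (delta_mx 0 (rshift N l)) j = (l == j)%:R *:
  (r 0 l *: et l).
Proof.
rewrite /planar !mxE !eqxx /= eq_lrshift (inj_eq (@rshift_inj _ _)) scale0r add0r.
by rewrite eq_sym scalerA mulrC; case: (l =P j) => [->|] //; rewrite !mul0r !scale0r.
Qed.

Let dot_reg_r j : dot (regular_pos eps r t j) (er j) = r 0 j - eps * dot (g j) (er j).
Proof.
by rewrite /regular_pos dotDl dotNl !dotZl dot_radial_radial mulr1.
Qed.
Let dot_reg_t j : dot (regular_pos eps r t j) (et j) = - eps * dot (g j) (et j).
Proof.
rewrite /regular_pos dotDl dotNl !dotZl.
have -> : dot (radial_dir (t 0 j)) (et j) = 0 by rewrite /et; planar_simp; ring.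
by rewrite mulr0 sub0r mulNr.
Qed.

(** The product of 1 / conj z and conj z for z = q_j - q_0.  It determines the
    deviation of the radii from 1 to first order in [eps], which contributes to
    the limit of [blk_tr]. *)
Lemma radius_eq j : r 0 j ^+ 2 + eps * (r 0 j * dot (er j) (\sum_i q i))
  - eps * (r 0 j * dot (g j) (er j)) - eps ^+ 2 * dot (g j) (\sum_i q i) = 1.
Proof.
have z0 := equilibrium_sep0 eq j; rewrite -dot_eq0 in z0.
have : dot (inv_conj (small_pos r t j - core_pos eps r t))
  (small_pos r t j - core_pos eps r t) = 1.
  by rewrite dotZl mulVf.
rewrite regE /regular_pos /core_pos /central_position -/q -/g scaleNr opprK.
set Q := \sum_i q i => h; rewrite -[RHS]h.
have e := dot_radial_radial (t 0 j); rewrite -/(er j) in e.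
rewrite -[r 0 j ^+ 2]mulr1 -e /q /small_pos -/(er j).
by clear h e; move: (g j) (er j) (r 0 j) Q => [g1 g2] [c s] rj [Q1 Q2]; planar_simp; ring.
Qed.

Lemma linearization_blocks : linearization eps r t =
  block_mx (eps *: blk_rr eps r t) (blk_rt eps r t) (eps *: blk_tr eps r t)
    (eps *: blk_tt eps r t).
Proof.
have row_l l j : linearization eps r t l j =
  ((delta_mx 0 l : 'rV[R]_(N + N)) *m linearization eps r t) 0 j.
  by rewrite -rowE [RHS]mxE.
apply/matrixP => l j; rewrite row_l (mul_linearization eq).
case: (split_ordP l) => l' ->; case: (split_ordP j) => j' ->;
  rewrite ?row_mxEl ?row_mxEr ?block_mxEul ?block_mxEur ?block_mxEdl ?block_mxEdr
    ![in LHS]mxE ![in RHS]mxE.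
- rewrite (field_diff_delta _ (planar_r l')) /er /et.
  move: (coupling _ _ _ _ _ _) => cp; rewrite !(dotDl, dotZl, dotNl).
  have [<-|] := pselect (l' = j'); last by move/eqP/negPf => ->; rewrite !mul0r !add0r.
  rewrite eqxx dot_kernel_rr dot_reg_r dot_reg_t perp_radial dot_angular_radial.
  by rewrite /er /et; ring.
- rewrite (field_diff_delta _ (planar_r l')) /er /et.
  move: (coupling _ _ _ _ _ _) => cp; rewrite !(dotDl, dotZl, dotNl).
  have [<-|] := pselect (l' = j'); last by move/eqP/negPf => ->; rewrite !mul0r !add0r.
  by [].
- rewrite (field_diff_delta _ (planar_t l')) /er /et.
  move: (coupling _ _ _ _ _ _) => cp; rewrite !(dotDl, dotZl, dotNl).
  have [<-|] := pselect (l' = j'); last by move/eqP/negPf => ->; rewrite !mul0r !add0r.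
  rewrite eqxx kernel_diffZ perpZ perp_angular !(dotZl, dotNl) dot_kernel_tr
    dot_reg_r dot_reg_t.
  rewrite dot_radial_radial [RHS]mulrDr; congr (_ + _).
  have := radius_eq l'; rewrite /q /g /er /et.
  move: (\sum_i _) => Q.
  move: (dot (interaction r t l') (radial_dir (t 0 l'))) (dot _ (angular_dir _))
    (dot (radial_dir _) Q) (dot (interaction r t l') Q) => a b c d h.
  apply/eqP; rewrite -subr_eq0; apply/eqP.
  transitivity (r 0 l' *
    (1 - (r 0 l' ^+ 2 + eps * (r 0 l' * c) - eps * (r 0 l' * a) - eps ^+ 2 * d))).
    by rewrite /=; ring.
  by rewrite h subrr mulr0.
- rewrite (field_diff_delta _ (planar_t l')) /er /et.
  move: (coupling _ _ _ _ _ _) => cp; rewrite !(dotDl, dotZl, dotNl).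
  have [<-|] := pselect (l' = j'); last by move/eqP/negPf => ->;
    rewrite !mul0r !add0r mulrA.
  rewrite eqxx kernel_diffZ perpZ perp_angular !(dotZl, dotNl) dot_kernel_tt
    dot_reg_r dot_reg_t.
  have -> : dot (radial_dir (t 0 l')) (angular_dir (t 0 l')) = 0 by planar_simp; ring.
  by rewrite /er /et /=; field.
Qed.
End At.
End Blocks.

(** * The blocks in the limit *)

Section LimitIdentities.
Variable R : realType.
Implicit Types a b d : R.

Lemma dot_radial a b : dot (radial_dir a) (radial_dir b) = cos (a - b).
Proof. by rewrite cosB. Qed.

(** The angle b is expressed by a and the difference, which makes the
    identities below homogeneous in (cos a, sin a). *)
Let trig a b : exists c s x y,
  [/\ radial_dir a = (c, s) :> R * R, radial_dir b = (c * x + s * y, s * x - c * y),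
   c ^+ 2 + s ^+ 2 = 1, y ^+ 2 = 1 - x ^+ 2 & cos (a - b) = x].
Proof.
exists (cos a), (sin a), (cos (a - b)), (sin (a - b)); split=> //.
- have {1}-> : b = a - (a - b) by rewrite subKr.
  by move: (a - b) => d; rewrite /radial_dir cosB sinB.
- exact: cos2Dsin2.
by rewrite sin2cos2.
Qed.

Lemma dot_sep a b : dot (radial_dir a - radial_dir b) (radial_dir a - radial_dir b)
  = 2 - 2 * cos (a - b).
Proof.
have [c [s [x [y [-> -> e f ->]]]]] := trig a b.
transitivity ((c ^+ 2 + s ^+ 2) * ((1 - x) ^+ 2 + y ^+ 2)); first by planar_simp; ring.
by rewrite e f; ring.
Qed.

Lemma radial_sep a b : cos (a - b) != 1 -> radial_dir a - radial_dir b != 0.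
Proof.
move=> h; rewrite -dot_eq0 dot_sep; apply: contraNneq h => h; apply/eqP; lra.
Qed.

Lemma csqrZ (c : R) p : csqr (c *: p) = c ^+ 2 *: csqr p.
Proof. by apply: pairP; planar_simp; ring. Qed.
Lemma kernel_diffZk (c : R) (k w : R * R) : kernel_diff (c *: k) w = c *: kernel_diff k w.
Proof. by apply: pairP; planar_simp; ring. Qed.

Lemma dot_interaction a b : cos (a - b) != 1 ->
  dot (inv_conj (radial_dir a - radial_dir b)) (radial_dir a) = 2^-1.
Proof.
move=> h; rewrite dotZl dot_sep; move: h.
have [c [s [x [y [-> -> e f ->]]]]] := trig a b => h.
have -> : dot ((c, s) - (c * x + s * y, s * x - c * y)) (c, s) =
  (c ^+ 2 + s ^+ 2) * (1 - x).
  by planar_simp; ring.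
by rewrite e mul1r; field; apply/eqP => h2; case/eqP: h; lra.
Qed.

Lemma dot_pair_self a b : cos (a - b) != 1 ->
  dot (kernel_diff (csqr (inv_conj (radial_dir a - radial_dir b))) (angular_dir a))
    (radial_dir a)
  = 2^-1 * (cos (a - b) / (1 - cos (a - b))).
Proof.
move=> h; rewrite csqrZ kernel_diffZk dotZl dot_sep -[angular_dir a]perp_radial; move: h.
have [c [s [x [y [-> -> e f ->]]]]] := trig a b => h.
have -> : dot (kernel_diff (csqr ((c, s) - (c * x + s * y, s * x - c * y)))
  (perp (c, s))) (c, s)
    = - (c ^+ 2 + s ^+ 2) ^+ 2 * ((1 - x) ^+ 2 - y ^+ 2).
  by planar_simp; ring.
by rewrite e f; field; apply/andP; split; apply/eqP => h2; case/eqP: h; lra.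
Qed.

Lemma dot_pair_cross a b : cos (a - b) != 1 ->
  dot (kernel_diff (csqr (inv_conj (radial_dir a - radial_dir b))) (angular_dir b))
    (radial_dir a)
  = 2^-1 / (1 - cos (a - b)).
Proof.
move=> h; rewrite csqrZ kernel_diffZk dotZl dot_sep -[angular_dir b]perp_radial; move: h.
have [c [s [x [y [-> -> e f ->]]]]] := trig a b => h.
have -> : dot (kernel_diff (csqr ((c, s) - (c * x + s * y, s * x - c * y)))
     (perp (c * x + s * y, s * x - c * y))) (c, s)
    = - (c ^+ 2 + s ^+ 2) ^+ 2 * (x * ((1 - x) ^+ 2 - y ^+ 2) - 2 * (1 - x) * y ^+ 2).
  by planar_simp; ring.
by rewrite e f; field; apply/andP; split; apply/eqP => h2; case/eqP: h; lra.
Qed.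

Lemma dot_core a b :
  dot (kernel_diff (csqr (radial_dir a)) (angular_dir b)) (radial_dir a) = - cos (a - b).
Proof.
rewrite -[angular_dir b]perp_radial.
have [c [s [x [y [-> -> e f ->]]]]] := trig a b.
transitivity (- (c ^+ 2 + s ^+ 2) ^+ 2 * x); first by planar_simp; ring.
by rewrite e; ring.
Qed.
Lemma dot_core_self a :
  dot (kernel_diff (csqr (radial_dir a)) (radial_dir a)) (angular_dir a) = - 1.
Proof.
have e := cos2Dsin2 a.
transitivity (- (cos a ^+ 2 + sin a ^+ 2) ^+ 2); first by planar_simp; ring.
by rewrite e expr1n.
Qed.
End LimitIdentities.

Section LimitBlocks.
Variables (R : realType) (N : nat) (t : 'rV[R]_N).
Hypothesis st : distinct_angles t.
Let one : 'rV[R]_N := const_mx 1.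

Let posE j : small_pos one t j = radial_dir (t 0 j).
Proof. by rewrite /small_pos mxE scale1r. Qed.

Let regE j : regular_pos 0 one t j = radial_dir (t 0 j).
Proof. by rewrite /regular_pos scale0r subr0 posE. Qed.

Lemma blk_rt_limit : blk_rt 0 one t = (- 2)%:M.
Proof.
apply/matrixP => l j;
  rewrite !mxE mul0r addr0 divr1 regE dotDl dotNl dot_angular_angular dot_core_self.
by case: (l == j); rewrite /= ?mulr1n ?mulr0n; ring.
Qed.

(** On the diagonal, each other vortex contributes a cosine through the shift
    of the core, 1/2 through the corrections of order eps in the equilibrium
    equation, and the differential of the mutual interaction; the sum of the
    three is [pair_stiffness]. *)
Lemma blk_tr_limit : blk_tr 0 one t = potential_hessian t.
Proof.
apply/matrixP => l j;
  rewrite !mxE !mul0r !mul1r !subr0 scale1r /coupling !(dotDl, dotNl, dotZl) regE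
    dot_core.
have cj i : i != j -> cos (t 0 j - t 0 i) != 1 by move=> ij; apply: st; rewrite eq_sym.
have [->|lj] := pselect (l = j).
  rewrite eqxx !mul1r pair_kernelxx kernel_diff0.
  have -> : dot (0 : R * R) (radial_dir (t 0 j)) = 0 by planar_simp; ring.
  rewrite !subr0 subrr cos0.
  have dsum (F : 'I_N -> R * R) (P : pred 'I_N) w : dot (\sum_(i | P i) F i) w =
    \sum_(i | P i) dot (F i) w.
    by rewrite /dot fst_sum snd_sum !mulr_suml -big_split.
  have -> : dot (radial_dir (t 0 j)) (\sum_i small_pos one t i) = 1
    + \sum_(i < N | i != j) cos (t 0 j - t 0 i).
    transitivity (dot (\sum_i small_pos one t i) (radial_dir (t 0 j)));
      first by planar_simp; ring.
    rewrite dsum (bigD1 j) //= posE dot_radial_radial; congr (_ + _);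
      apply: eq_bigr => i _.
    by rewrite posE dot_radial -cosN opprB.
  rewrite /interaction !dsum.
  have -> : \sum_(i < N | i != j) dot
    (inv_conj (small_pos one t j - small_pos one t i)) (radial_dir (t 0 j))
     = \sum_(i < N | i != j) 2^-1.
    by apply: eq_bigr => i ij; rewrite !posE dot_interaction // cj.
  have -> : \sum_(i < N | i != j) dot
    (kernel_diff (pair_kernel one t j i) (angular_dir (t 0 j))) (radial_dir (t 0 j))
     = \sum_(i < N | i != j) 2^-1 * (cos (t 0 j - t 0 i) / (1 - cos (t 0 j - t 0 i))).
    by apply: eq_bigr => i ij; rewrite /pair_kernel !posE dot_pair_self // cj.
  set A := \sum_(i < N | i != j) cos _; set B := \sum_(i < N | i != j) 2^-1.
  set C := \sum_(i < N | i != j) _ * (_ / _).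
  transitivity (A + B + C); first by ring.
  rewrite /A /B /C -!big_split; apply: eq_bigr => i ij /=.
  rewrite eq_sym (negPf ij) /pair_stiffness /=; field.
  by have := cj i ij; rewrite subr_eq0 eq_sym.
have /eqP/negPf lj' := lj; rewrite lj' !mul0r !add0r.
rewrite (bigD1 l) //=; last exact/eqP.
rewrite eqxx big1 => [|i /andP[_ il]]; last by rewrite eq_sym (negPf il) subrr mulr0.
rewrite addr0 /pair_kernel !posE dot_pair_cross; last by apply: cj; apply/eqP.
by rewrite /pair_stiffness /=; ring.
Qed.
End LimitBlocks.

(** * Passage to the limit *)

Section Convergence.
Variable R : realType.
Definition cvg2 (f : nat -> R * R) (l : R * R) :=
  (fun k => (f k).1) @ \oo --> l.1 /\ (fun k => (f k).2) @ \oo --> l.2.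

Lemma cvg2_cst l : cvg2 (fun=> l) l. Proof. by split; exact: cvg_cst. Qed.
Lemma cvg2D f g a b : cvg2 f a -> cvg2 g b -> cvg2 (fun k => f k + g k) (a + b).
Proof. by move=> [f1 f2] [g1 g2]; split; apply: cvgD. Qed.
Lemma cvg2B f g a b : cvg2 f a -> cvg2 g b -> cvg2 (fun k => f k - g k) (a - b).
Proof. by move=> [f1 f2] [g1 g2]; split; apply: cvgB. Qed.
Lemma cvg2Z (c : nat -> R) (c0 : R) f a : c @ \oo --> c0 -> cvg2 f a ->
  cvg2 (fun k => c k *: f k) (c0 *: a).
Proof. by move=> hc [f1 f2]; split; apply: cvgM. Qed.
Lemma cvg2_sum (I : finType) (P : pred I) (f : I -> nat -> R * R) l :
  (forall i, P i -> cvg2 (f i) (l i)) ->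
  cvg2 (fun k => \sum_(i | P i) f i k) (\sum_(i | P i) l i).
Proof.
move=> h; split; rewrite ?fst_sum ?snd_sum.
  by under eq_fun do rewrite fst_sum; apply: cvg_sumr => i /h[].
by under eq_fun do rewrite snd_sum; apply: cvg_sumr => i /h[].
Qed.
Lemma cvg_dot f g a b : cvg2 f a -> cvg2 g b -> (fun k => dot (f k) (g k)) @ \oo -->
  dot a b.
Proof. by move=> [f1 f2] [g1 g2]; apply: cvgD; apply: cvgM. Qed.
Lemma cvg2_perp f a : cvg2 f a -> cvg2 (fun k => perp (f k)) (perp a).
Proof. by move=> [f1 f2]; split=> //; apply: cvgN. Qed.
Lemma cvg_cross f g a b : cvg2 f a -> cvg2 g b -> (fun k => cross (f k) (g k)) @ \oo
  --> cross a b.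
Proof. by move=> hf hg; apply: cvg_dot => //; exact: cvg2_perp. Qed.
Lemma cvg2_csqr f a : cvg2 f a -> cvg2 (fun k => csqr (f k)) (csqr a).
Proof.
move=> [f1 f2]; split; first by apply: cvgB; apply: cvgM.
by apply: cvgM; [exact: cvg_cst|apply: cvgM].
Qed.
Lemma cvg2_kernel_diff f g a b : cvg2 f a -> cvg2 g b ->
  cvg2 (fun k => kernel_diff (f k) (g k)) (kernel_diff a b).
Proof.
move=> [f1 f2] [g1 g2]; split; first by apply: cvgB; apply: cvgM.
by apply: cvgN; apply: cvgD; apply: cvgM.
Qed.
Lemma cvg2_inv_conj f a : a != 0 -> cvg2 f a ->
  cvg2 (fun k => inv_conj (f k)) (inv_conj a).
Proof.
rewrite -dot_eq0 => a0 hf; apply: cvg2Z => //; apply: cvgV => //; exact: cvg_dot.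
Qed.
End Convergence.

Section BlockLimits.
Variables (R : realType) (N : nat) (eps : nat -> R) (rho phi : nat -> 'rV[R]_N)
  (t : 'rV[R]_N).
Hypothesis cvg_eps : eps @ \oo --> (0 : R).
Hypothesis cvg_rho : rho @ \oo --> (const_mx 1 : 'rV[R]_N).
Hypothesis cvg_phi : phi @ \oo --> t.
Hypothesis st : distinct_angles t.
Let one : 'rV[R]_N := const_mx 1.

Let crho j : (fun k => rho k 0 j) @ \oo --> one 0 j.
Proof. by apply: (cvg_comp rho (fun x : 'rV[R]_N => x 0 j) cvg_rho);
  exact: coord_continuous. Qed.
Let cphi j : (fun k => phi k 0 j) @ \oo --> t 0 j.
Proof. by apply: (cvg_comp phi (fun x : 'rV[R]_N => x 0 j) cvg_phi);
  exact: coord_continuous. Qed.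
Let ccos j : (fun k => cos (phi k 0 j)) @ \oo --> cos (t 0 j).
Proof. by apply: continuous_cvg; [exact: continuous_cos|exact: cphi]. Qed.
Let csin j : (fun k => sin (phi k 0 j)) @ \oo --> sin (t 0 j).
Proof. by apply: continuous_cvg; [exact: continuous_sin|exact: cphi]. Qed.
Let crad j : cvg2 (fun k => radial_dir (phi k 0 j)) (radial_dir (t 0 j)).
Proof. by split; [exact: ccos|exact: csin]. Qed.
Let cang j : cvg2 (fun k => angular_dir (phi k 0 j)) (angular_dir (t 0 j)).
Proof. by split; [apply: cvgN; exact: csin|exact: ccos]. Qed.
Let crang j : cvg2 (fun k => rho k 0 j *: angular_dir (phi k 0 j))
  (one 0 j *: angular_dir (t 0 j)).
Proof. by apply: cvg2Z. Qed.
Let cpos j : cvg2 (fun k => small_pos (rho k) (phi k) j) (small_pos one t j).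
Proof. by apply: cvg2Z. Qed.

Let cinv i j : i != j ->
  cvg2 (fun k => inv_conj (small_pos (rho k) (phi k) j - small_pos (rho k) (phi k) i))
  (inv_conj (small_pos one t j - small_pos one t i)).
Proof.
move=> ij; apply: cvg2_inv_conj; last exact: cvg2B.
by rewrite /small_pos !mxE !scale1r radial_sep // st // eq_sym.
Qed.
Let cint j : cvg2 (fun k => interaction (rho k) (phi k) j) (interaction one t j).
Proof. by apply: cvg2_sum => i ij; exact: cinv. Qed.
Let cker j i : cvg2 (fun k => pair_kernel (rho k) (phi k) j i) (pair_kernel one t j i).
Proof.
have [->|ij] := pselect (i = j); last by apply: cvg2_csqr; apply: cinv; exact/eqP.
by under eq_fun do rewrite pair_kernelxx; rewrite pair_kernelxx; exact: cvg2_cst.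
Qed.
Let creg j : cvg2 (fun k => regular_pos (eps k) (rho k) (phi k) j)
  (regular_pos 0 one t j).
Proof. by apply: cvg2B => //; exact: cvg2Z. Qed.
Let ccoup l j (W : nat -> R * R) W0 : cvg2 W W0 ->
  cvg2 (fun k => coupling (eps k) (rho k) (phi k) l (W k) j) (coupling 0 one t l W0 j).
Proof.
move=> hW; apply: cvg2B; last exact: cvg2_kernel_diff.
apply: cvg2D; last by apply: cvg2_kernel_diff => //; exact: cvg2_csqr.
apply: cvg2Z; first exact: cvg_cst.
by apply: cvg2_sum => i _; exact: cvg2_kernel_diff.
Qed.
Let cg1 j : (fun k => dot (interaction (rho k) (phi k) j) (radial_dir (phi k 0 j)))
  @ \oo -->
   dot (interaction one t j) (radial_dir (t 0 j)).
Proof. exact: cvg_dot. Qed.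
Let cg2 j : (fun k => dot (interaction (rho k) (phi k) j) (angular_dir (phi k 0 j)))
  @ \oo -->
   dot (interaction one t j) (angular_dir (t 0 j)).
Proof. exact: cvg_dot. Qed.
Let cQ : cvg2 (fun k => \sum_i small_pos (rho k) (phi k) i) (\sum_i small_pos one t i).
Proof. by apply: cvg2_sum. Qed.
Let cinvr j : (fun k => (rho k 0 j)^-1) @ \oo --> (one 0 j)^-1.
Proof. by apply: cvgV => //; rewrite mxE oner_eq0. Qed.
Let cst (c : R) : (fun _ : nat => c) @ \oo --> c. Proof. exact: cvg_cst. Qed.

Lemma cvg_blk_rr : mx_cvg (fun k => blk_rr (eps k) (rho k) (phi k)) (blk_rr 0 one t).
Proof.
move=> i j.
under eq_fun do rewrite mxE; rewrite mxE.
apply: cvgD; last by apply: cvg_dot => //; exact: ccoup.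
apply: cvgM => //; apply: cvgM; first exact: cvgM.
by apply: cvgB => //; exact: cvgM.
Qed.
Lemma cvg_blk_rt : mx_cvg (fun k => blk_rt (eps k) (rho k) (phi k)) (blk_rt 0 one t).
Proof.
move=> i j.
under eq_fun do rewrite mxE; rewrite mxE.
apply: cvgM => //; apply: cvgD; apply: cvgM => //.
  by apply: cvg_dot => //; apply: cvg2B => //; apply: cvg2_kernel_diff => //;
    exact: cvg2_csqr.
by apply: cvg_dot => //; exact: ccoup.
Qed.
Lemma cvg_blk_tr : mx_cvg (fun k => blk_tr (eps k) (rho k) (phi k)) (blk_tr 0 one t).
Proof.
move=> i j.
under eq_fun do rewrite mxE; rewrite mxE.
apply: cvgD; last by apply: cvg_dot => //; exact: ccoup.
apply: cvgM => //; apply: cvgM => //; apply: cvgB; [apply: cvgD; [apply: cvgB|]|].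
- by apply: cvgM => //; exact: cvg_dot.
- by apply: cvgM => //; exact: cvg_dot.
- exact: cvgM.
by apply: cvgM => //; apply: cvgB; apply: cvgM.
Qed.
Lemma cvg_blk_tt : mx_cvg (fun k => blk_tt (eps k) (rho k) (phi k)) (blk_tt 0 one t).
Proof.
move=> i j.
under eq_fun do rewrite mxE; rewrite mxE.
apply: cvgM => //; apply: cvgD; last by apply: cvg_dot => //; exact: ccoup.
apply: cvgM => //; apply: cvgM => //; apply: cvgM; first exact: cvgM.
by apply: cvgB => //; exact: cvgM.
Qed.

Let centry u w u0 w0 (i j : 'I_N) : cvg2 u u0 -> cvg2 w w0 ->
  (fun k => symplectic_entry (eps k) (u k) (w k) i j) @ \oo -->
    symplectic_entry 0 u0 w0 i j.
Proof. by move=> hu hw; apply: cvgM; [exact: cvgD|exact: cvg_cross]. Qed.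

Hypothesis N0 : (0 < N)%N.
Hypothesis eps0 : forall k, eps k != 0.
Hypothesis equil : forall k, polar_rel_equilibrium (eps k) (rho k) (phi k).
Hypothesis cH : (char_poly (potential_hessian t))`_1 != 0.

(** Both signs of eps are treated at once; sg = 1 leads to minima and sg = - 1 to
    maxima. *)
Lemma stability_sign (sg : R) : sg * sg = 1 ->
  \forall k \near \oo, eps k = sg * `|eps k| ->
  nondegenerate_equilibrium (eps k) (rho k) (phi k) /\
  (linearly_stable (eps k) (rho k) (phi k) <->
    forall x : 'rV[R]_N, 0 <= qform (sg *: potential_hessian t) x x).
Proof.
move=> sg2.
pose er k j := radial_dir (phi k 0 j).
pose et k j := rho k 0 j *: angular_dir (phi k 0 j).
pose P k : 'M[R]_N := \matrix_(j, l) symplectic_entry (eps k) (er k j) (er k l) j l.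
pose Q k : 'M[R]_N := \matrix_(j, l) symplectic_entry (eps k) (er k j) (et k l) j l.
pose T k : 'M[R]_N := \matrix_(j, l) symplectic_entry (eps k) (et k j) (er k l) j l.
pose V k : 'M[R]_N := \matrix_(j, l) cross (et k j) (et k l).
pose er0 j := radial_dir (t 0 j).
pose et0 j := one 0 j *: angular_dir (t 0 j).
have cvg_P : mx_cvg P (\matrix_(j, l) symplectic_entry 0 (er0 j) (er0 l) j l).
  by move=> i j; under eq_fun do rewrite mxE; rewrite mxE;
    exact: centry (crad _) (crad _).
have cvg_Q : mx_cvg Q 1%:M.
  move=> i j; under eq_fun do rewrite mxE.
  have -> : (1%:M : 'M[R]_N) i j = symplectic_entry 0 (er0 i) (et0 j) i j.
    rewrite /symplectic_entry /er0 /et0 !mxE scale1r addr0.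
    have [->|ij] := pselect (i = j); last by move/eqP/negPf: ij => ->; rewrite mul0r.
    by rewrite eqxx /cross perp_radial dot_angular_angular mulr1.
  exact: centry (crad _) (crang _).
have cvg_T : mx_cvg T (- 1)%:M.
  move=> i j; under eq_fun do rewrite mxE.
  have -> : ((- 1)%:M : 'M[R]_N) i j = symplectic_entry 0 (et0 i) (er0 j) i j.
    rewrite /symplectic_entry /er0 /et0 !mxE scale1r addr0.
    have [->|ij] := pselect (i = j); last by move/eqP/negPf: ij => ->; rewrite mul0r.
    by rewrite eqxx /cross perp_angular dotNl dot_radial_radial mul1r.
  exact: centry (crang _) (crad _).
have cvg_V : mx_cvg V (\matrix_(j, l) cross (et0 j) (et0 l)).
  by move=> i j; under eq_fun do rewrite mxE; rewrite mxE;
     exact: cvg_cross (crang _) (crang _).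
rewrite /nondegenerate_equilibrium /linearly_stable.
apply: (@slow_fast_stability R N sg (potential_hessian t) eps
  (fun k => linearization (eps k) (rho k) (phi k))
  (fun k => symplectic_mx (eps k) (rho k) (phi k)) _ _ _ _ P Q T V _ _ _ _ rho)
  cvg_blk_rr _ _ cvg_blk_tt cvg_P cvg_Q cvg_T cvg_V _ _ _ _ _ _ => //.
- exact: potential_hessian_sym.
- exact: potential_hessian_rotation.
- by rewrite -(blk_rt_limit t); exact: cvg_blk_rt.
- by rewrite -blk_tr_limit //; exact: cvg_blk_tr.
- by move=> k; exact: linearization_blocks (equil k).
- move=> k; congr block_mx; apply/matrixP => j l; rewrite !mxE /symplectic_entry.
  (* The diagonal terms of order one vanish, since cross u u = 0. *)
  have [->|jl] := pselect (j = l); last by move/eqP/negPf: jl => ->; rewrite add0r.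
  have -> : cross (et k l) (et k l) = 0 by planar_simp; ring.
  by rewrite !mulr0.
- by move=> k; exact: rotation_kernel.
- by move=> k; exact: dilation_eq.
- by move=> k; exact: symplectic_mx_antisym.
- by move=> k; exact: linearization_hamiltonian.
Qed.
End BlockLimits.

(** * Stability of the relative equilibria *)

(** Only finitely many indices come before [K]. *)
Lemma sequence_lower_bound (R : realType) (u : nat -> R) (K : nat) :
  (forall k, u k != 0) -> exists2 e, 0 < e & forall k, `|u k| < e -> (K <= k)%N.
Proof.
move=> u0; elim: K => [|K [e e0 he]]; first by exists 1.
exists (Num.min e `|u K|); first by rewrite lt_min e0 normr_gt0 u0.
move=> k; rewrite lt_min => /andP[/he Kk uk].
by rewrite ltn_neqAle Kk andbT; apply: contraTneq uk => ->; rewrite ltxx.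
Qed.

Theorem theorem2 (R : realType) (N : nat) (hN : (0 < N)%N)
    (eps : nat -> R) (rho phi : nat -> 'rV[R]_N) (phi0 : 'rV[R]_N)
    (eps_neq0 : forall k, eps k != 0)
    (eps_cvg : eps @ \oo --> (0 : R))
    (equil : forall k, polar_rel_equilibrium (eps k) (rho k) (phi k))
    (rho_cvg : rho @ \oo --> (const_mx 1 : 'rV[R]_N))
    (phi_cvg : phi @ \oo --> phi0)
    (limit_equil :
       limit_rel_equilibrium (polar_config 0 (const_mx 1 : 'rV[R]_N) phi0))
    (phi0_crit : nondegenerate_critical_point phi0) :
  exists eps0 : R, 0 < eps0 /\
    forall k, 0 < `|eps k| < eps0 ->
      [/\ nondegenerate_equilibrium (eps k) (rho k) (phi k),
          0 < eps k ->
            (linearly_stable (eps k) (rho k) (phi k)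
               <-> nondegenerate_local_min phi0)
        & eps k < 0 ->
            (linearly_stable (eps k) (rho k) (phi k)
               <-> nondegenerate_local_max phi0)].
Proof.
have [[noncol _] mult] := phi0_crit.
have sep := noncollision_distinct noncol.
have hE := hessian_potential sep.
rewrite hE in mult.
have [c0 c1] := mup1_coef (monic_neq0 (char_poly_monic _)) mult.
have rk := simple_kernel c0 c1.
have minE : (forall x : 'rV[R]_N, 0 <= qform (1 *: potential_hessian phi0) x x) <->
    nondegenerate_local_min phi0.
  rewrite /nondegenerate_local_min hE scale1r.
  by split=> [h|[]].
have maxE : (forall x : 'rV[R]_N, 0 <= qform (- 1 *: potential_hessian phi0) x x) <->
    nondegenerate_local_max phi0.
  have qN x : qform (- 1 *: potential_hessian phi0) x x = - qform (potential_hessian phi0) x x.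
    by rewrite scaleN1r /qform mulmxN mulNmx mxE.
  rewrite /nondegenerate_local_max hE; split=> [h|[_ h _] x].
    by split=> // x; have := h x; rewrite qN oppr_ge0.
  by rewrite qN oppr_ge0; exact: h.
have sign := stability_sign eps_cvg rho_cvg phi_cvg sep hN eps_neq0 equil c1.
have pos := sign 1 (mulr1 1).
have neg : \forall k \near \oo, eps k = - 1 * `|eps k| ->
  nondegenerate_equilibrium (eps k) (rho k) (phi k) /\
  (linearly_stable (eps k) (rho k) (phi k) <->
    forall x : 'rV[R]_N, 0 <= qform (- 1 *: potential_hessian phi0) x x).
  by apply: sign; rewrite mulrNN mulr1.
have [K _ hK] : \forall k \near \oo, _ /\ _ := filterI pos neg.
have [e e0 he] := sequence_lower_bound K eps_neq0.
exists e; split=> // k /andP[_ /he /hK [hp hn]].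
have [k0|k0|k0] := ltgtP (eps k) 0; last by have := eps_neq0 k; rewrite k0 eqxx.
- have [|nd st] := hn; first by rewrite ltr0_norm // mulrNN mul1r.
  by split=> // _; rewrite st.
have [|nd st] := hp; first by rewrite gtr0_norm // mul1r.
by split=> // _; rewrite st.
Qed.
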